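(* Let $a,b$ be real with $a>-1$, $b>-1$, $a+b\ge-1$, and put $\varepsilon=\frac{a+b+1}{2}$. Let $N>K\ge1$ be integers, $L=N-K+1$, $\nu\in\mathrm{Sign}^+_N$, $\varkappa\in\mathrm{Sign}^+_K$, and write $F_N(t)=F_N(t;\nu;\varepsilon)$. Then $$ \frac{\Lambda^N_K(\nu,\varkappa)}{d_K(\varkappa;\varepsilon)}=\det\big[(g_{K-j}F_N:\, g_{\varkappa_i+K-i})\big]_{i,j=1}^K . $$
   Context: $\mathrm{Sign}^+_N$ is the set of $N$-tuples of integers $\nu_1\ge\dots\ge\nu_N\ge0$. Jacobi polynomials: $P^{(a,b)}_n(x)$ is the classical Jacobi polynomial of degree $n$, orthogonal with weight $(1-x)^a(1+x)^b$ on $[-1,1]$. For $\nu\in\mathrm{Sign}^+_N$, $$P^{(a,b)}_{\nu,N}(x_1,\dots,x_N)=\frac{\det[P^{(a,b)}_{\nu_i+N-i}(x_j)]_{i,j=1}^N}{\prod_{1\le i<j\le N}(x_i-x_j)},\qquad \widetilde P^{(a,b)}_{\nu,N}(x_1,\dots,x_N)=\frac{P^{(a,b)}_{\nu,N}(x_1,\dots,x_N)}{P^{(a,b)}_{\nu,N}(1,\dots,1)}.$$ The coefficients $\Lambda^N_K(\nu,\varkappa)$ (depending also on $(a,b)$) are defined by the expansion $$\widetilde P^{(a,b)}_{\nu,N}(x_1,\dots,x_K,1,\dots,1)=\sum_{\varkappa\in\mathrm{Sign}^+_K}\Lambda^N_K(\nu,\varkappa)\,\widetilde P^{(a,b)}_{\varkappa,K}(x_1,\dots,x_K).$$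 Further notation: $$F_N(t;\nu;\varepsilon)=\prod_{i=1}^N\frac{t^2-(N-i+\varepsilon)^2}{t^2-(\nu_i+N-i+\varepsilon)^2},$$ $$d_K(\varkappa;\varepsilon)=\prod_{1\le i<j\le K}\frac{(\varkappa_i+K-i+\varepsilon)^2-(\varkappa_j+K-j+\varepsilon)^2}{(K-i+\varepsilon)^2-(K-j+\varepsilon)^2},$$ $$g_k(t)={}_4F_3\left[\begin{matrix}-k,\ k+2\varepsilon,\ L,\ L+a\\ -t+L+\varepsilon,\ t+L+\varepsilon,\ a+1\end{matrix}\,\Big|\,1\right],\quad k=0,1,2,\dots$$ (a terminating series, hence a rational function of $t$). $\mathcal F(\varepsilon,L)$ is the vector space of even rational functions $f(t)$ of a complex variable $t$ that are regular at $t=\infty$ and whose only singularities are simple poles contained in $\{\pm A_m: m\ge1\}$, where $A_m=L+\varepsilon+m-1$. The functions $g_0,g_1,g_2,\dots$ form a basis of $\mathcal F(\varepsilon,L)$, and each function $g_{K-j}F_N$, $1\le j\le K$, lies in $\mathcal F(\varepsilon,L)$. For $\phi\in\mathcal F(\varepsilon,L)$, $(\phi:g_k)$ denotes the coefficient of $g_k$ in the (finite) expansion $\phi=\sum_{k\ge0}(\phi:g_k)g_k$. *)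

(* Defs.v *)
(* Built on MathComp, with real-closed and multinomials; [realType] comes from
   MathComp-Analysis. *)
From Stdlib Require Import ClassicalEpsilon.
From HB Require Import structures.
From mathcomp Require Import all_boot all_order all_algebra.
From mathcomp Require Import complex mpoly.
From mathcomp Require Import reals.

Set Implicit Arguments.
Unset Strict Implicit.
Unset Printing Implicit Defensive.

Import Order.TTheory GRing.Theory Num.Theory.

Local Open Scope ring_scope.
Local Open Scope complex_scope.

(** Signatures *)

(* Weakly decreasing [N]-tuples of nonnegative integers.  Coordinates are
   numbered from 0, so the textbook index [i] is [i.+1] throughout. *)
Definition signature (N : nat) : Type := {nu : N.-tuple nat | sorted geq nu}.

(* nu_i + N - i *)
Definition shifted (N : nat) (nu : signature N) (i : 'I_N) : nat :=
  (tnth (val nu) i + (N - i.+1))%N.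

(** Coefficients of finite linear expansions *)

(* [c] is a finitely supported family with v = sum_i (c i) (b i); the scalars
   are sent to the ring [V] by [emb]. *)
Definition expansion (F V : nzRingType) (emb : F -> V) (I : choiceType)
    (b : I -> V) (v : V) (c : I -> F) : Prop :=
  exists s : seq I, [/\ uniq s, forall i, i \notin s -> c i = 0
    & v = \sum_(i <- s) emb (c i) * b i].

(** Terminating hypergeometric series *)

Definition poch (F : fieldType) (x : F) (m : nat) : F :=
  \prod_(i < m) (x + i%:R).

(* m-th coefficient of the series pFq[num; den | z] *)
Definition hyp_coef (F : fieldType) (num den : seq F) (m : nat) : F :=
  (\prod_(u <- num) poch u m) / ((\prod_(v <- den) poch v m) * m`!%:R).

(** Jacobi polynomials *)

(* P_n^(a,b)(x) = (a+1)_n / n! 2F1[-n, n+a+b+1; a+1 | (1-x)/2] *)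
Definition jacobi (R : realType) (a b : R) (n : nat) : {poly R} :=
  (poch (a + 1) n / n`!%:R) *:
  \sum_(m < n.+1)
     hyp_coef [:: - n%:R; n%:R + a + b + 1] [:: a + 1] m
       *: (2^-1 *: (1 - 'X)) ^+ m.

Definition jacobi_det (R : realType) (a b : R) (N : nat) (nu : signature N) :
    {mpoly R[N]} :=
  \det (\matrix_(i < N, j < N)
     horner_alg ('X_j : {mpoly R[N]}) (jacobi a b (shifted nu i))).

Definition vandermonde_prod (R : realType) (N : nat) : {mpoly R[N]} :=
  \prod_(i < N) \prod_(j < N | (i < j)%N) ('X_i - 'X_j).

(* The quotient of the two preceding polynomials, as a polynomial: this is what
   gives a meaning to its values at points with equal coordinates. *)
Definition mjacobi (R : realType) (a b : R) (N : nat) (nu : signature N) :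
    {mpoly R[N]} :=
  epsilon (inhabits 0)
    (fun P => P * vandermonde_prod R N = jacobi_det a b nu).

Definition mjacobi_normalized (R : realType) (a b : R) (N : nat)
    (nu : signature N) : {mpoly R[N]} :=
  (mjacobi a b nu).@[fun=> 1]^-1 *: mjacobi a b nu.

(* p(x_1, ..., x_K, 1, ..., 1) *)
Definition specialize (R : realType) (N K : nat) (p : {mpoly R[N]}) :
    {mpoly R[K]} :=
  p \mPo [tuple (if insub (val i) is Some j then 'X_(j : 'I_K) else 1) | i < N].

(* Lambda^N_K(nu, .): the family of coefficients in the expansion of
   P~_nu(x_1, ..., x_K, 1, ..., 1) on the P~_kappa, kappa a signature of length
   K.  These are linearly independent, so that the family is unique. *)
Definition Lambda (R : realType) (a b : R) (N K : nat) (nu : signature N) :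
    signature K -> R :=
  epsilon (inhabits (fun=> 0))
    (expansion (@mpolyC K R) (@mjacobi_normalized R a b K)
       (specialize K (mjacobi_normalized a b nu))).

Definition dK (R : realType) (K : nat) (kappa : signature K) (eps : R) : R :=
  \prod_(i < K) \prod_(j < K | (i < j)%N)
    ((((shifted kappa i)%:R + eps) ^+ 2 - ((shifted kappa j)%:R + eps) ^+ 2) /
     (((K - i.+1)%:R + eps) ^+ 2 - ((K - j.+1)%:R + eps) ^+ 2)).

(** Rational functions of a complex variable *)

Definition ratfun (R : realType) : fieldType := {fraction {poly R[i]}}.

Definition ratC (R : realType) (z : R[i]) : ratfun R := tofrac z%:P.

Definition ratR (R : realType) (x : R) : ratfun R := ratC x%:C.

Definition rat_t (R : realType) : ratfun R := tofrac 'X.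

(* Defined as a product in the field of rational functions, so common factors of
   numerator and denominator cancel even when both vanish at a given t. *)
Definition FN (R : realType) (N : nat) (nu : signature N) (eps : R) :
    ratfun R :=
  \prod_(i < N)
    ((rat_t R ^+ 2 - ratR ((N - i.+1)%:R + eps) ^+ 2) /
     (rat_t R ^+ 2 - ratR ((shifted nu i)%:R + eps) ^+ 2)).

(* g_k(t): the 4F3 series at 1, whose terms of index m > k vanish. *)
Definition gfun (R : realType) (a eps : R) (L k : nat) : ratfun R :=
  \sum_(m < k.+1)
    hyp_coef
      [:: - k%:R; ratR (k%:R + 2 * eps); L%:R; ratR (L%:R + a)]
      [:: - rat_t R + ratR (L%:R + eps); rat_t R + ratR (L%:R + eps);
          ratR (a + 1)] m.

Definition even_ratfun (R : realType) (f : ratfun R) : Prop :=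
  exists p q : {poly R[i]}, [/\ q != 0, f = tofrac p / tofrac q
    & f = tofrac (p \Po (- 'X)) / tofrac (q \Po (- 'X))].

Definition regular_at (R : realType) (z : R[i]) (f : ratfun R) : Prop :=
  exists p q : {poly R[i]}, q.[z] != 0 /\ f = tofrac p / tofrac q.

Definition regular_at_infty (R : realType) (f : ratfun R) : Prop :=
  exists p q : {poly R[i]},
    [/\ q != 0, (size p <= size q)%N & f = tofrac p / tofrac q].

(* A_m = L + eps + m - 1 *)
Definition pole (R : realType) (eps : R) (L m : nat) : R[i] :=
  (L%:R + eps + m%:R - 1)%:C.

(* The space F(eps, L): the last clause says that [f] is regular everywhere
   except possibly at some +-A_m, m >= 1, where a pole is at most simple. *)
Definition calF (R : realType) (eps : R) (L : nat) (f : ratfun R) : Prop :=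
  [/\ even_ratfun f, regular_at_infty f
    & forall z, regular_at z f \/
        (exists2 m, (1 <= m)%N & z = pole eps L m \/ z = - pole eps L m) /\
        regular_at z ((rat_t R - ratC z) * f)].

(* [gcoef a eps L phi k] is (phi : g_k), for phi in F(eps, L).  Linear
   independence of the g_k makes the family of coefficients unique. *)
Definition gcoef (R : realType) (a eps : R) (L : nat) (phi : ratfun R) :
    nat -> R[i] :=
  epsilon (inhabits (fun=> 0))
    (fun c => calF eps L phi /\ expansion (@ratC R) (gfun a eps L) phi c).

(* Main.v *)
From Stdlib Require Import ClassicalEpsilon.
From HB Require Import structures.
Require Import Defs.
From mathcomp Require Import all_boot all_order all_fingroup all_algebra.
From mathcomp Require Import complex mpoly ring zify lra.
From mathcomp Require Import reals.

Set Implicit Arguments.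
Unset Strict Implicit.
Unset Printing Implicit Defensive.

Import Order.TTheory GRing.Theory Num.Theory.

Local Open Scope ring_scope.
Local Open Scope complex_scope.

(* With u = (1-x)/2 and y_n = (n+eps)^2, the Jacobi polynomial normalized at
   x = 1 is J_n(u) = sum_m c_m(n) u^m, where c_m(n) is a constant times
   e_m(y_n) = prod_(r<m) (y_n - y_r).  Put D = N - K = L - 1.  Dividing the
   alternant det [J_(n_i)(u_j)] by the Vandermonde product by means of divided
   differences, the last D variables can be set to u = 0: their columns become
   the c_m(n_i), m < D, while the other ones involve the tails
   T_n = sum_m c_(D+m)(n) u^m only.  Multiplying by the matrix of the
   b_r(y_i) / prod_(j != i) (y_i - y_j), b_r monic of degree r, makes this N x N
   determinant block triangular, by Lagrange interpolation; there remains the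
   K x K alternant of the polynomials
   U_r = sum_i b_r(y_i) / prod_(j != i) (y_i - y_j) T_(n_i).

   The linear map u^m |-> (L)_m (L+a)_m / prod_(r<m) (y_(L+r) - t^2) sends J_k to
   g_k and, by a telescoping sum, T_n to a constant times
   e_D(y_n) (t^2 - y_D) / (t^2 - y_n).  Hence the partial fraction expansion of
   g_(K-j) F_N says that g_(K-j) F_N is the image of a combination of the U_r,
   triangular in j, and its coefficients on the g_k are those of this combination
   on the J_k. *)

(** * Divided differences *)

(* Divided difference of X^m at z_0, ..., z_j, computed by the Leibniz rule for
   X * X^m'. *)
Fixpoint newton (A : comNzRingType) (z : nat -> A) (m j : nat) : A :=
  if m is m'.+1 then
    z j * newton z m' j + (if j is j'.+1 then newton z m' j' else 0)
  else (j == 0%N)%:R.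

(** Newton interpolation is exact at [z k] for every [N > k], since the terms with [j > k] contain
    the factor [z k - z k]. In the induction on [m], the new factor [z k] is written in the [j]-th
    term as [z j + (z k - z j)]. *)
Lemma newton_exp (A : comNzRingType) (z : nat -> A) (N m k : nat) :
  (k < N)%N ->
  z k ^+ m = \sum_(j < N) newton z m j * \prod_(r < j) (z k - z r).
Proof.
move=> kN; elim: m => [|m IH].
  case: N kN => // N _; rewrite big_ord_recl /= big_ord0 mulr1 big1 ?addr0 //.
  by move=> i _; rewrite /= mul0r.
(* The parts [z k - z j] move the index up by one; the term pushed past the end vanishes because its
   product contains [r = k]. *)
have shift : \sum_(j < N) newton z m j * \prod_(r < j.+1) (z k - z r) =
    \sum_(j < N) (if j : nat is j'.+1 then newton z m j' else 0)
       * \prod_(r < j) (z k - z r).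
  case: N kN {IH} => // N kN.
  rewrite big_ord_recr /= [RHS]big_ord_recl /= mul0r add0r.
  rewrite (_ : \prod_(r < N.+1) (z k - z r) = 0) ?mulr0 ?addr0 //.
  by rewrite (bigD1 (Ordinal kN)) //= subrr mul0r.
rewrite exprS IH mulr_sumr.
under [RHS]eq_bigr do rewrite /= mulrDl.
rewrite big_split /= -shift -big_split /=; apply: eq_bigr => j _.
by rewrite big_ord_recr /=; ring.
Qed.

Lemma rmorph_newton (A B : comNzRingType) (f : {rmorphism A -> B})
    (z : nat -> A) (m j : nat) :
  f (newton z m j) = newton (f \o z) m j.
Proof.
elim: m j => [|m IH] j /=; first by rewrite rmorph_nat.
by rewrite rmorphD rmorphM IH; case: j => [|j]; rewrite ?rmorph0 ?IH.
Qed.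

Lemma eq_newton (A : comNzRingType) (z z' : nat -> A) (m j : nat) :
  z =1 z' -> newton z m j = newton z' m j.
Proof. by move=> zz'; elim: m j => [|m IH] //= [|j]; rewrite ?IH zz'. Qed.

(** A divided difference at a point repeated [j + 1] times is the Taylor coefficient of order [j]
    there. *)
Lemma newton_zero (A : comNzRingType) (z : nat -> A) (D m j : nat) :
  (forall r, (r < D)%N -> z r = 0) -> (j < D)%N -> newton z m j = (m == j)%:R.
Proof.
move=> z0; elim: m j => [|m IH] j jD /=; first by rewrite eq_sym.
by rewrite z0 // mul0r add0r; case: j jD => // j jD; rewrite IH // ltnW.
Qed.

(** [D] zeros among the points discard the powers below [D] and divide the others by X^D: this is
    where the tails T_n come from. *)
Lemma newton_shift (A : comNzRingType) (z : nat -> A) (D m j : nat) :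
  (forall r, (r < D)%N -> z r = 0) ->
  newton z m (D + j) =
  if (m < D)%N then 0 else newton (fun r => z (D + r)%N) (m - D) j.
Proof.
move=> z0; elim: m j => [|m IH] j.
  by case: D z0 => [|D] _ //=.
rewrite /= IH; case: j => [|j].
  rewrite addn0; case: D z0 IH => [|D] z0 IH; first by rewrite ltn0 !subn0 /= !addr0.
  rewrite (newton_zero _ z0) // !ltnS subSS.
  case: ltngtP => mD; rewrite ?mulr0 ?addr0 //.
    by rewrite -[in RHS]subnSK //= !addr0 addn0.
  by rewrite mD subnn add0r.
rewrite addnS IH.
case: (ltngtP m.+1 D) => [mD|mD|<-].
- by rewrite mulr0 addr0.
- by rewrite subSn //= addnS.
- by rewrite subnn mulr0 addr0.
Qed.

(* The points in reverse order (0 beyond the last one): the variables that are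
   specialized to u = 0 are the last ones, and they must come first in newton. *)
Definition rev_pts (A : comNzRingType) (N : nat) (x : 'I_N -> A) (r : nat) : A :=
  oapp (fun i => x (rev_ord i)) 0 (insub r).

Lemma rev_ptsE (A : comNzRingType) (N : nat) (x : 'I_N -> A) (i : 'I_N) :
  rev_pts x (rev_ord i) = x i.
Proof. by rewrite /rev_pts valK /= rev_ordK. Qed.

Definition newton_mx (A : comNzRingType) (n N : nat) (x : 'I_N -> A) :
    'M[A]_(n, N) :=
  \matrix_(m < n, s < N) newton (rev_pts x) m (rev_ord s).

Definition powers_mx (A : comNzRingType) (n N : nat) (x : 'I_N -> A) :
    'M[A]_(n, N) := \matrix_(m < n, s < N) x s ^+ m.

(** Newton's formula factors the matrix of powers through a triangular matrix whose determinant is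
    the Vandermonde product. No division takes place, so the first determinant keeps its meaning at
    coinciding points. *)
Lemma det_newton (A : comNzRingType) (n N : nat) (C : 'M[A]_(N, n))
    (x : 'I_N -> A) :
  \det (C *m newton_mx n x) * \prod_(i < N) \prod_(j < N | (i < j)%N) (x i - x j)
  = \det (C *m powers_mx n x).
Proof.
pose Nw := \matrix_(s < N, k < N)
  \prod_(r < rev_ord s) (x k - rev_pts x r).
have -> : powers_mx n x = newton_mx n x *m Nw.
  apply/matrixP => m k; rewrite !mxE -(rev_ptsE x k) (newton_exp _ _ (ltn_ord _)).
  rewrite (reindex_inj rev_ord_inj); apply: eq_bigr => s _.
  by rewrite !mxE rev_ptsE.
rewrite mulmxA det_mulmx; congr (_ * _).
rewrite det_trig.
  apply: eq_bigr => k _; rewrite !mxE; symmetry.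
  rewrite (big_ord_widen N (fun r => x k - rev_pts x r)) ?leq_subr //.
  rewrite (reindex_inj rev_ord_inj) /=; apply: eq_big => [j|j _].
    have := ltn_ord j; have := ltn_ord k; lia.
  by rewrite -/(rev_ord j : nat) rev_ptsE.
apply/is_trig_mxP => s k sk; rewrite !mxE.
have ks' : (rev_ord k < rev_ord s)%N.
  have := ltn_ord k; have := ltn_ord s; rewrite /=; lia.
by rewrite (bigD1 (Ordinal ks')) //= -/(rev_ord k : nat) rev_ptsE subrr mul0r.
Qed.

(** * Lagrange interpolation *)

Definition lagrange_weight (R : fieldType) (N : nat) (y : 'I_N -> R) (i : 'I_N) : R :=
  (\prod_(j | j != i) (y i - y j))^-1.

Lemma lagrange_weight_neq0 (R : fieldType) (N : nat) (y : 'I_N -> R) (i : 'I_N) :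
  injective y -> \prod_(j | j != i) (y i - y j) != 0.
Proof.
move=> yI; apply/prodf_neq0 => j ji.
by rewrite subr_eq0 (inj_eq yI) eq_sym.
Qed.

Lemma size_prod_XsubC_predC1 (R : fieldType) (N : nat) (y : 'I_N -> R) (i : 'I_N) :
  size (\prod_(j | j != i) ('X - (y j)%:P)) = N.
Proof.
rewrite size_prod => [|j _]; last by rewrite polyXsubC_eq0.
under eq_bigr do rewrite size_XsubC.
rewrite sum_nat_const; have := cardC1 i; rewrite card_ord => ->.
have := ltn_ord i; lia.
Qed.

Lemma lagrange (R : fieldType) (N : nat) (y : 'I_N -> R) (P : {poly R}) :
  injective y -> (size P <= N)%N ->
  P = \sum_i (P.[y i] * lagrange_weight y i) *:
        \prod_(j | j != i) ('X - (y j)%:P).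
Proof.
move=> yI sP; apply/eqP; rewrite -subr_eq0; apply/negPn/negP => nz.
have := max_poly_roots nz (rs := [seq y i | i <- enum 'I_N]).
rewrite map_inj_uniq ?enum_uniq // size_map size_enum_ord => /(_ _ isT) H.
have {H} : (N < N)%N; last by rewrite ltnn.
apply: leq_trans (H _) _.
  apply/allP => _ /mapP[i _ ->]; rewrite rootE !hornerE horner_sum.
  rewrite (bigD1 i) //= [X in _ - (_ + X)]big1 => [|j ji].
    rewrite addr0 hornerZ horner_prod.
    under eq_bigr do rewrite !hornerE.
    by rewrite mulfVK ?subrr // lagrange_weight_neq0.
  rewrite hornerZ horner_prod (bigD1 i) 1?eq_sym //= hornerXsubC subrr.
  by rewrite mul0r mulr0.
rewrite (leq_trans (size_polyD _ _)) // geq_max sP size_polyN.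
apply: (leq_trans (size_sum _ _ _)); apply/bigmax_leqP => i _.
by rewrite (leq_trans (size_scale_leq _ _)) // size_prod_XsubC_predC1.
Qed.

(** Coefficients of degree N-1 are compared in Lagrange's formula. For monic [P] the sum is thus 1
    in degree N-1 and 0 in lower degree, an orthogonality relation. *)
Lemma lagrange_coef (R : fieldType) (N : nat) (y : 'I_N -> R) (P : {poly R}) :
  injective y -> (size P <= N)%N ->
  \sum_i P.[y i] * lagrange_weight y i = P`_N.-1.
Proof.
move=> yI sP; rewrite [in RHS](lagrange yI sP) coef_sum; apply: eq_bigr => i _.
rewrite coefZ -[X in _`_X.-1](size_prod_XsubC_predC1 y i) -lead_coefE.
by rewrite (eqP (monic_prod _ _)) ?mulr1 // => j _; rewrite monicXsubC.
Qed.

(** Partial fractions: Lagrange's formula at [s], divided by the polynomial of the nodes. *)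
Lemma lagrange_frac (R F : fieldType) (f : {rmorphism R -> F}) (N : nat)
    (y : 'I_N -> R) (P : {poly R}) (s : F) :
  injective y -> (size P <= N)%N -> (forall i, s != f (y i)) ->
  (map_poly f P).[s] / \prod_i (s - f (y i)) =
  \sum_i f (P.[y i] * lagrange_weight y i) / (s - f (y i)).
Proof.
move=> yI sP sy; rewrite {1}(lagrange yI sP) rmorph_sum horner_sum mulr_suml.
apply: eq_bigr => i _; rewrite /= map_polyZ hornerZ -mulrA; congr (_ * _).
rewrite rmorph_prod horner_prod.
under eq_bigr do rewrite rmorphB /= map_polyX map_polyC /= hornerXsubC.
rewrite [\prod_i0 (s - _)](bigD1 i) //= invfM mulrCA divff ?mulr1 //.
by apply/prodf_neq0 => j _; rewrite subr_eq0.
Qed.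

(** * Alternants of monic families *)

Lemma det_monic (R : comNzRingType) (N : nat) (b : nat -> {poly R}) (y : 'I_N -> R) :
  (forall r, b r \is monic) -> (forall r, size (b r) = r.+1) ->
  \det (\matrix_(r < N, i < N) (b r).[y i]) =
  \prod_(i < N) \prod_(j < N | (i < j)%N) (y j - y i).
Proof.
move=> bm bs.
have -> : \matrix_(r < N, i < N) (b r).[y i] =
    (\matrix_(r < N, k < N) (b r)`_k) *m Vandermonde N (\row_i y i).
  apply/matrixP => r i; rewrite !mxE (@horner_coef_wide _ N) ?bs //.
  by apply: eq_bigr => k _; rewrite !mxE.
rewrite det_mulmx det_trig; last first.
  by apply/is_trig_mxP => r k rk; rewrite mxE nth_default // bs.
rewrite det_Vandermonde big1 ?mul1r => [|r _].
  by apply: eq_bigr => i _; apply: eq_bigr => j _; rewrite !mxE.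
by rewrite mxE -[X in _`_X]/(r.+1.-1) -bs -lead_coefE (eqP (bm _)).
Qed.

(** The two triangular products together run once over the ordered pairs of distinct indices, just
    like the denominators of the weights. *)
Lemma prod_lagrange_weight (R : fieldType) (N : nat) (y : 'I_N -> R) :
  injective y ->
  (\prod_(i < N) \prod_(j < N | (i < j)%N) (y j - y i)) *
  (\prod_(i < N) lagrange_weight y i) *
  (\prod_(i < N) \prod_(j < N | (i < j)%N) (y i - y j)) = 1.
Proof.
move=> yI; rewrite prodfV mulrAC; set W := \prod_i \prod_(j | j != i) _.
have W0 : W != 0.
  by apply/prodf_neq0 => i _; apply: lagrange_weight_neq0.
suff -> : \prod_(i < N) \prod_(j < N | (i < j)%N) (y j - y i) *
  \prod_(i < N) \prod_(j < N | (i < j)%N) (y i - y j) = W by rewrite divff.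
rewrite (exchange_big_dep predT) //= -big_split /=; apply: eq_bigr => i _.
rewrite [RHS](bigID (fun j : 'I_N => (j < i)%N)) /=; congr (_ * _).
  by apply: eq_bigl => j; rewrite -val_eqE /=; case: ltngtP.
apply: eq_bigl => j; rewrite -leqNgt -val_eqE /=; case: ltngtP => //.
Qed.

(** Left multiplication by [B], of determinant 1/V, turns the right-hand columns into [ga m] times
    the coefficients of degree K+D-1 of the products [b r * e m]. These vanish for r + m < K+D-1, so
    that the upper right block is zero and the lower right one is triangular. *)
Lemma det_alternant_block (R : fieldType) (A : comNzRingType)
    (f : {rmorphism R -> A}) (K D : nat) (y : 'I_(K + D) -> R)
    (b e : nat -> {poly R}) (ga : nat -> R) (X : 'M[A]_(K + D, K)) :
  injective y ->
  (forall r, b r \is monic) -> (forall r, size (b r) = r.+1) ->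
  (forall r, e r \is monic) -> (forall r, size (e r) = r.+1) ->
  \det (row_mx X (\matrix_(i < K + D, s < D)
                     f (ga (rev_ord s) * (e (rev_ord s)).[y i]))) =
  f ((\prod_(m < D) ga m) *
     \prod_(i < K + D) \prod_(j < K + D | (i < j)%N) (y i - y j)) *
  \det (map_mx f (\matrix_(r < K, i < K + D) ((b r).[y i] * lagrange_weight y i)) *m X).
Proof.
move=> yI bm bs em es; set M := row_mx _ _.
set V := \prod_(i < K + D) _.
pose B : 'M[R]_(K + D) := \matrix_(r, i) ((b r).[y i] * lagrange_weight y i).
have detB : \det B * V = 1.
  rewrite -(prod_lagrange_weight yI); congr (_ * _).
  have -> : B = (\matrix_(r < K + D, i < K + D) (b r).[y i]) *m
                diag_mx (\row_i lagrange_weight y i).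
    by apply/matrixP => r i; rewrite mul_mx_diag !mxE.
  rewrite det_mulmx det_monic // det_diag; congr (_ * _).
  by apply: eq_bigr => i _; rewrite mxE.
have sume r m : (r + m < K + D)%N ->
    \sum_i (b r).[y i] * lagrange_weight y i * (ga m * (e m).[y i])
    = ga m * (r + m == (K + D).-1)%:R.
  move=> rm; transitivity (ga m * (b r * e m)`_(K + D).-1).
    rewrite -(lagrange_coef yI); last first.
      by rewrite size_monicM -?size_poly_eq0 ?bs ?es // addnS /= addSn.
    rewrite mulr_sumr; apply: eq_bigr => i _; rewrite hornerM; ring.
  congr (_ * _); have sz : size (b r * e m) = (r + m).+1.
    by rewrite size_monicM -?size_poly_eq0 ?bs ?es // addnS /= addSn.
  case: eqP => [<-|neq].
    rewrite -[X in _`_X]/((r + m).+1.-1) -sz -lead_coefE.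
    by apply/monicP; rewrite rpredM.
  rewrite nth_default // sz; lia.
(* The reversed order of the columns puts the entries with r + m = K+D-1, equal to [ga m], on the
   diagonal of this lower right block. *)
pose Z := \matrix_(r < D, s < D) (\sum_i (b (K + r)%N).[y i] *
  lagrange_weight y i * (ga (rev_ord s) * (e (rev_ord s)).[y i])).
have BM : map_mx f B *m M =
    block_mx (map_mx f (\matrix_(r < K, i < K + D) ((b r).[y i] * lagrange_weight y i)) *m X)
      0 (map_mx f (dsubmx B) *m X)
      (map_mx f Z).
  rewrite -{1}[B]vsubmxK map_col_mx mul_col_mx !mul_mx_row; congr col_mx; last first.
    congr row_mx; apply/matrixP => r s; rewrite !mxE.
    rewrite rmorph_sum; apply: eq_bigr => i _.
    by rewrite !mxE -rmorphM.
  congr row_mx.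
    by congr (_ *m _); apply/matrixP => r i; rewrite !mxE.
  apply/matrixP => r s; rewrite !mxE.
  have := ltn_ord r; have := ltn_ord s => hs hr.
  rewrite -[RHS](rmorph0 f) -[in RHS](mulr0 (ga (rev_ord s))).
  have -> : (0 : R) = (r + rev_ord s == (K + D).-1)%N%:R.
    by case: eqP => //= H; exfalso; lia.
  rewrite -sume; last by rewrite /=; lia.
  rewrite rmorph_sum; apply: eq_bigr => i _.
  by rewrite !mxE -rmorphM.
have := congr1 (fun Q => \det Q) BM.
rewrite det_mulmx det_map_mx det_lblock det_map_mx => H.
have -> : \det M = f V * (f (\det B) * \det M).
  by rewrite mulrA -rmorphM mulrC [V * _]mulrC detB rmorph1 mulr1.
rewrite {}H mulrCA mulrC -rmorphM; congr (f _ * _); rewrite mulrC.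
congr (_ * _).
rewrite det_trig; last first.
  apply/is_trig_mxP => r s rs; rewrite mxE.
  have := ltn_ord r; have := ltn_ord s => hs hr.
  rewrite sume /=; last by lia.
  by case: eqP => /= H; rewrite ?mulr0 //; exfalso; lia.
rewrite (reindex_inj rev_ord_inj); apply: eq_bigr => r _; rewrite mxE rev_ordK.
have := ltn_ord r => hr; rewrite sume /=; last by lia.
by case: eqP => /= H; rewrite ?mulr1 //; exfalso; lia.
Qed.

(** * Signatures and expansions of determinants *)

Lemma shifted_ltn (K : nat) (kappa : signature K) (i j : 'I_K) :
  (i < j)%N -> (shifted kappa j < shifted kappa i)%N.
Proof.
move=> ij; rewrite /shifted -addnS leq_add //; last first.
  have := ltn_ord i; have := ltn_ord j; lia.
have geq_trans : transitive geq by move=> ? ? ? /[swap]; apply: leq_trans.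
have := sorted_leq_nth geq_trans leqnn 0%N (valP kappa).
move=> /(_ i j); rewrite !inE !size_tuple !ltn_ord => /(_ isT isT (ltnW ij)).
by rewrite !(tnth_nth 0%N).
Qed.

Lemma shifted_inj (K : nat) (kappa : signature K) : injective (shifted kappa).
Proof.
move=> i j eq_ij; apply/val_inj/eqP; case: ltngtP => //= /(shifted_ltn kappa);
  by rewrite eq_ij ltnn.
Qed.

Lemma eq_shifted (K : nat) (kappa lam : signature K) :
  shifted kappa =1 shifted lam -> kappa = lam.
Proof.
move=> eq_s; apply/val_inj/eq_from_tnth => i.
by have := eq_s i; rewrite /shifted => /addIn.
Qed.

Lemma sorted_shifted (K : nat) (kappa : signature K) :
  sorted gtn [seq shifted kappa i | i <- enum 'I_K].
Proof.
have gtn_trans : transitive gtn by move=> ? ? ? /[swap]; apply: ltn_trans.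
apply: (homo_sorted (e := fun i j : 'I_K => (i < j)%N)).
  by move=> i j; apply: shifted_ltn.
by have := iota_ltn_sorted 0 K; rewrite -val_enum_ord sorted_map.
Qed.

(** The shifted sequences are strictly decreasing of the same length, so an inclusion of their sets
    of values is an equality, and the set determines the sequence. *)
Lemma sub_shifted (K : nat) (kappa lam : signature K) :
  (forall i, exists j, shifted kappa i = shifted lam j) -> kappa = lam.
Proof.
move=> sub; apply: eq_shifted => i.
have eq_map : [seq shifted kappa i | i <- enum 'I_K] =
    [seq shifted lam i | i <- enum 'I_K].
  have gtn_trans : transitive gtn by move=> ? ? ? /[swap]; apply: ltn_trans.
  apply: (irr_sorted_eq gtn_trans); rewrite ?sorted_shifted //.
    by move=> n; apply: ltnn.
  apply: (uniq_min_size _ _ _).2; rewrite ?size_map //.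
    by rewrite map_inj_uniq ?enum_uniq //; apply: shifted_inj.
  move=> _ /mapP[k _ ->]; have [j ->] := sub k.
  by rewrite map_f ?mem_enum.
by have /eq_in_map -> := eq_map; rewrite ?mem_enum.
Qed.

(** The signature is the decreasing rearrangement of the values minus the staircase K-1, ..., 0. *)
Lemma sort_shifted (K : nat) (f : 'I_K -> nat) :
  injective f ->
  exists kappa : signature K, exists s : 'S_K, forall i, f (s i) = shifted kappa i.
Proof.
move=> fI; pose t := [tuple f i | i < K].
have geq_total : total geq by move=> m n; apply: leq_total.
have /tuple_permP[s sE] : perm_eq (sort geq t) t by rewrite perm_sort.
have u_t : uniq (sort geq t).
  by rewrite sort_uniq map_inj_uniq // val_ord_tuple enum_uniq.
have gtn_trans : transitive gtn by move=> ? ? ? /[swap]; apply: ltn_trans.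
have srt : sorted gtn (sort geq t).
  by rewrite gtn_sorted_uniq_geq u_t sort_sorted.
have ntht i : tnth t (s i) = nth 0%N (sort geq t) i.
  by rewrite sE -tnth_nth [RHS]tnth_mktuple.
have szt : size (sort geq t) = K by rewrite size_sort size_tuple.
have gtnP (i j : nat) : (i < j < K)%N ->
    (nth 0%N (sort geq t) j < nth 0%N (sort geq t) i)%N.
  move=> /andP[ij jK]; have := sorted_ltn_nth gtn_trans 0%N srt.
  by move=> /(_ i j); rewrite !inE szt jK (ltn_trans ij jK) => /(_ isT isT ij).
(* Strict decrease loses at least [d] in [d] steps; hence the sorted values dominate the staircase
   and the truncated subtraction in [k] is exact. *)
have gap (d i : nat) : (d + i < K)%N ->
    (nth 0%N (sort geq t) (d + i) + d <= nth 0%N (sort geq t) i)%N.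
  elim: d => [|d IH] dK; first by rewrite addn0.
  have := gtnP (d + i)%N (d.+1 + i)%N; have := IH; lia.
pose k := [tuple (nth 0%N (sort geq t) i - (K - i.+1))%N | i < K].
have kE i : tnth k i = (nth 0%N (sort geq t) i - (K - i.+1))%N.
  by rewrite tnth_mktuple.
have ge i : (i < K)%N -> (K - i.+1 <= nth 0%N (sort geq t) i)%N.
  by move=> iK; have := gap (K - i.+1)%N i; lia.
have srtk : sorted geq k.
  apply/(sortedP 0%N) => i; rewrite size_tuple => iK.
  have iK' := ltnW iK; have := gtnP i i.+1.
  have := kE (Ordinal iK); have := kE (Ordinal iK').
  rewrite !(tnth_nth 0%N) /= => -> ->; lia.
exists (exist _ k srtk), s => i.
by rewrite /shifted /= kE -[LHS](tnth_mktuple f) ntht subnK // ge.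
Qed.

(** The Cauchy-Binet formula before grouping: multilinearity in the rows gives a sum over all maps,
    injective or not. *)
Lemma det_mulmx_ffun (A : comNzRingType) (K n : nat) (G : 'M[A]_(K, n))
    (V : 'M[A]_(n, K)) :
  \det (G *m V) = \sum_(f : {ffun 'I_K -> 'I_n})
    (\prod_i G i (f i)) * \det (\matrix_(i < K, s < K) V (f i) s).
Proof.
pose GV (s : 'S_K) i j := G i j * V j (s i).
transitivity (\sum_(f : {ffun 'I_K -> 'I_n}) \sum_(s : 'S_K)
    (-1) ^+ s * \prod_i GV s i (f i)).
  rewrite exchange_big; apply: eq_bigr => /= s _; rewrite -big_distrr /=.
  congr (_ * _); rewrite -(bigA_distr_bigA (GV s)) /=.
  by apply: eq_bigr => x _; rewrite mxE.
apply: eq_bigr => f _; rewrite mulr_sumr; apply: eq_bigr => s _.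
rewrite big_split /= mulrCA; congr (_ * (_ * _)).
by apply: eq_bigr => i _; rewrite mxE.
Qed.

Lemma expansion_sum (F V : nzRingType) (f : {rmorphism F -> V}) (I : choiceType)
    (b : I -> V) (t : seq (I * F)) :
  exists c, expansion f b (\sum_(p <- t) f p.2 * b p.1) c.
Proof.
(* Repeated indices of [t] are merged, since [expansion] asks for a duplicate-free support. *)
exists (fun i => \sum_(p <- t | p.1 == i) p.2).
exists (undup (map fst t)); split; first exact: undup_uniq.
  move=> i; rewrite mem_undup => /mapP nip; rewrite big1_seq // => p /andP[/eqP pi pt].
  by case: nip; exists p.
under [RHS]eq_bigr do rewrite rmorph_sum mulr_suml /=.
rewrite (exchange_big_dep predT) //= big_seq [RHS]big_seq.
apply: eq_bigr => p pt; under eq_bigl do rewrite eq_sym.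
rewrite big_mkcond (bigD1_seq p.1) ?undup_uniq ?mem_undup ?map_f //= eqxx.
by rewrite big1 ?addr0 // => i /negPf ->.
Qed.

(** In the sum over maps, a non-injective map gives two equal rows, and an injective one is, up to
    the sign of a permutation, the shifted sequence of a signature. *)
Lemma det_expansion (F A : comNzRingType) (f : {rmorphism F -> A}) (K n : nat)
    (G : 'M[F]_(K, n)) (V : nat -> 'I_K -> A) :
  exists t : seq (signature K * F),
    \det (map_mx f G *m \matrix_(k < n, s < K) V k s) =
    \sum_(p <- t) f p.2 * \det (\matrix_(i < K, s < K) V (shifted p.1 i) s).
Proof.
rewrite det_mulmx_ffun.
pose D (kappa : signature K) := \det (\matrix_(i < K, s < K) V (shifted kappa i) s).
pose spanned x := exists t : seq (signature K * F), x = \sum_(p <- t) f p.2 * D p.1.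
apply: (big_ind spanned) => [|x y [t ->] [u ->]|h _].
- by exists [::]; rewrite big_nil.
- by exists (t ++ u); rewrite big_cat.
case: (boolP (injectiveb h)) => [/injectiveP hI|/injectivePn[i [j ij hij]]]; last first.
  exists [::]; rewrite big_nil (determinant_alternate ij) ?mulr0 // => s.
  by rewrite !mxE hij.
have hI' : injective (fun i => h i : nat) by move=> i j /val_inj/hI.
have [kappa [s hs]] := sort_shifted hI'.
exists [:: (kappa, (\prod_i G i (h i)) * (-1) ^+ s)]; rewrite big_seq1 /=.
rewrite rmorphM rmorph_prod rmorph_sign -mulrA; congr (_ * _).
  by apply: eq_bigr => i _; rewrite mxE.
set M := \matrix_(i, s) _.
have -> : D kappa = \det (row_perm s M).
  by congr (\det _); apply/matrixP => i j; rewrite !mxE hs.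
rewrite row_permE det_mulmx det_perm mulrA -[_ * _ ^+ s]expr2 sqrr_sign mul1r.
by congr (\det _); apply/matrixP => i j; rewrite !mxE.
Qed.

(** * Alternants in the variables u_s = (1 - x_s) / 2 and their linear independence *)

Definition uvar (R : fieldType) (K : nat) (s : 'I_K) : {mpoly R[K]} :=
  2^-1 *: (1 - 'X_s).

Definition ueval (R : fieldType) (K : nat) (p : {poly R}) (s : 'I_K) : {mpoly R[K]} :=
  (map_poly (@mpolyC K R) p).[uvar R s].

Definition alternant (R : fieldType) (K : nat) (p : 'I_K -> {poly R}) : {mpoly R[K]} :=
  \det (\matrix_(i < K, s < K) ueval (p i) s).

Section Independence.
Variables (R : numFieldType) (J : nat -> {poly R}).
Hypothesis size_J : forall k, size (J k) = k.+1.

(** A triangular change of basis times the Vandermonde matrix of the distinct points 0, ..., n-1. *)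
Lemma unitmx_eval_nodes (n : nat) :
  \matrix_(k < n, a < n) (J k).[a%:R] \in unitmx.
Proof.
have -> : \matrix_(k < n, a < n) (J k).[a%:R] =
    (\matrix_(k < n, m < n) (J k)`_m) *m Vandermonde n (\row_(a < n) a%:R).
  apply/matrixP => r i; rewrite !mxE (@horner_coef_wide _ n) ?size_J //.
  by apply: eq_bigr => k _; rewrite !mxE.
rewrite unitmx_mul !unitmxE !unitfE det_Vandermonde; apply/andP; split.
  rewrite det_trig; last first.
    by apply/is_trig_mxP => r k rk; rewrite mxE nth_default // size_J.
  apply/prodf_neq0 => k _; rewrite mxE.
  by rewrite -[X in _`_X]/(k.+1.-1) -size_J -lead_coefE lead_coef_eq0 -size_poly_eq0 size_J.
apply/prodf_neq0 => i _; apply/prodf_neq0 => j ij; rewrite !mxE subr_eq0.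
by rewrite eqr_nat neq_ltn ij orbT.
Qed.

Lemma meval_ueval (K : nat) (p : {poly R}) (s : 'I_K) (h : 'I_K -> R) :
  (ueval p s).@[fun i => 1 - 2 * h i] = p.[h s].
Proof.
rewrite /ueval -horner_map /= -map_poly_comp map_poly_id => [|x _]; last first.
  exact: mevalC.
rewrite /uvar mevalZ mevalB meval1 mevalXU; congr _.[_].
by rewrite subKr mulKf // pnatr_eq0.
Qed.

(* Evaluating on the grid {0, ..., n-1}^K and pairing with the inverse of the
   matrix of values of J extracts one coefficient of a K-fold tensor. *)
Lemma alternant_dual (K n : nat) (k : 'I_K -> 'I_n) :
  exists2 ell : {mpoly R[K]} -> R,
    (forall (I : Type) (r : seq I) (c : I -> R) (P : I -> {mpoly R[K]}),
      ell (\sum_(i <- r) c i *: P i) = \sum_(i <- r) c i * ell (P i)) &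
    forall g : 'I_K -> nat -> R,
      ell (alternant (fun i => \sum_(m < n) g i m *: J m)) =
      \det (\matrix_(i < K, s < K) g i (k s)).
Proof.
pose M := \matrix_(k < n, a < n) (J k).[a%:R].
pose Y := \matrix_(a < n, s < K) invmx M a (k s).
exists (fun p => \sum_(h : {ffun 'I_K -> 'I_n})
  (\prod_s Y (h s) s) * p.@[fun i => 1 - 2 * (h i)%:R]).
  move=> I r c P; under eq_bigr do rewrite raddf_sum mulr_sumr.
  rewrite exchange_big; apply: eq_bigr => i _; rewrite mulr_sumr.
  by apply: eq_bigr => h _; rewrite /= mevalZ mulrCA.
move=> g; pose G := \matrix_(i < K, m < n) g i m.
have -> : \matrix_(i < K, s < K) g i (k s) = G *m M *m Y.
  have MY m s : (M *m Y) m s = (m == k s)%:R.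
    have := mulmxV (unitmx_eval_nodes n); rewrite -/M => /matrixP/(_ m (k s)).
    rewrite !mxE => <-; apply: eq_bigr => a _; by rewrite [Y _ _]mxE.
  apply/matrixP => i s; rewrite -mulmxA !mxE (bigD1 (k s)) //= MY eqxx mulr1 mxE.
  by rewrite big1 ?addr0 // => m /negPf mk; rewrite MY mk mulr0.
rewrite -det_tr trmx_mul det_mulmx_ffun; apply: eq_bigr => h _; congr (_ * _).
  by apply: eq_bigr => s _; rewrite [RHS]mxE.
rewrite -det_map_mx -[LHS]det_tr; congr (\det _); apply/matrixP => s i.
rewrite !mxE /= meval_ueval horner_sum; apply: eq_bigr => m _.
by rewrite hornerZ !mxE.
Qed.

(** The functional dual to [shifted kappa] takes the value 1 on the alternant of [kappa] and 0 on
    those of the other signatures; it is applied to both sides. *)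
Lemma alternant_coef (K n : nat) (r : seq (signature K)) (c : signature K -> R)
    (g : 'I_K -> nat -> R) (kappa : signature K) :
  uniq r -> (forall lam, lam \notin r -> c lam = 0) ->
  (forall lam i, lam \in kappa :: r -> (shifted lam i < n)%N) ->
  alternant (fun i => \sum_(m < n) g i m *: J m) =
    \sum_(lam <- r) c lam *: alternant (fun i => J (shifted lam i)) ->
  c kappa = \det (\matrix_(i < K, s < K) g i (shifted kappa s)).
Proof.
move=> ur c0 rn eq_alt.
have kn i : (shifted kappa i < n)%N by rewrite rn ?mem_head.
have [ell ell_lin ellE] := alternant_dual (fun i => Ordinal (kn i)).
rewrite -[RHS](ellE g) eq_alt ell_lin.
have ell_basis lam : lam \in r ->
    ell (alternant (fun i => J (shifted lam i))) = (lam == kappa)%:R.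
  move=> lr; have ln i : (shifted lam i < n)%N by rewrite rn ?inE ?lr ?orbT.
  transitivity (ell (alternant
      (fun i => \sum_(m < n) (m == shifted lam i :> nat)%:R *: J m))).
    congr ell; congr (\det _); apply/matrixP => i s; rewrite !mxE; congr ueval.
    rewrite (bigD1 (Ordinal (ln i))) //= eqxx scale1r big1 ?addr0 // => m.
    by rewrite -val_eqE /= => /negPf ->; rewrite scale0r.
  rewrite (ellE (fun i m => (m == shifted lam i)%:R)) /=.
  case: eqP => [->|neq].
    rewrite -[RHS](det1 R K); congr (\det _); apply/matrixP => i s; rewrite !mxE.
    by rewrite (inj_eq (@shifted_inj _ kappa)) eq_sym.
  (* If [lam] differs from [kappa], some shifted entry of [lam] is missing from [kappa], and the
     corresponding row of the 0-1 matrix is zero. *)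
  have [i iP] : exists i, forall j, shifted lam i != shifted kappa j.
    case: (boolP [exists i, [forall j, shifted lam i != shifted kappa j]]).
      by move=> /existsP[i /forallP iP]; exists i.
    move=> /existsPn all_ex; case: neq.
    apply: sub_shifted => i; have /forallPn[j] := all_ex i.
    by rewrite negbK => /eqP; exists j.
  rewrite (expand_det_row _ i) big1 // => s _; rewrite !mxE eq_sym.
  by rewrite (negPf (iP s)) mul0r.
under eq_big_seq do rewrite ell_basis //.
case: (boolP (kappa \in r)) => [kr|nkr].
  rewrite (bigD1_seq kappa) //= eqxx mulr1 big1 ?addr0 // => lam /negPf ->.
  by rewrite mulr0.
rewrite c0 // big1_seq // => lam /= lr; case: eqP => [eq_lk|]; rewrite ?mulr0 //.
by rewrite eq_lk (negPf nkr) in lr.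
Qed.

End Independence.

(** * Jacobi polynomials in the variable (1 - x) / 2 *)

(** The y_n of the overview; [node_poly], [jac_coef] and [jac_poly] are its e_m, c_m(n) and J_n. *)
Definition node (R : nzRingType) (eps : R) (n : nat) : R := (n%:R + eps) ^+ 2.

Definition node_poly (R : nzRingType) (eps : R) (m : nat) : {poly R} :=
  \prod_(r < m) ('X - (node eps r)%:P).

Definition jac_norm (R : fieldType) (a : R) (m : nat) : R :=
  (-1) ^+ m / (poch (a + 1) m * m`!%:R).

Definition jac_coef (R : fieldType) (a eps : R) (m n : nat) : R :=
  jac_norm a m * (node_poly eps m).[node eps n].

Definition jac_poly (R : fieldType) (a eps : R) (n : nat) : {poly R} :=
  \poly_(m < n.+1) jac_coef a eps m n.

Lemma node_poly_monic (R : nzRingType) (eps : R) (m : nat) :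
  node_poly eps m \is monic.
Proof. by apply: monic_prod => r _; apply: monicXsubC. Qed.

Lemma size_node_poly (R : idomainType) (eps : R) (m : nat) :
  size (node_poly eps m) = m.+1.
Proof. by rewrite /node_poly size_prod_XsubC /index_enum -enumT size_enum_ord. Qed.

Lemma horner_node_poly (R : comNzRingType) (eps : R) (m : nat) (x : R) :
  (node_poly eps m).[x] = \prod_(r < m) (x - node eps r).
Proof. by rewrite horner_prod; apply: eq_bigr => r _; rewrite !hornerE. Qed.

(** Squaring is injective on nonnegative numbers. The condition on [eps] is what a + b >= -1
    provides. *)
Lemma node_inj (R : realFieldType) (eps : R) : 0 <= eps -> injective (node eps).
Proof.
move=> eps0 m n /eqP; rewrite eqrXn2 ?addr_ge0 // => /eqP/addIr/eqP.
by rewrite eqr_nat => /eqP.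
Qed.

Lemma poch_neq0 (R : realFieldType) (x : R) (m : nat) : 0 < x -> poch x m != 0.
Proof.
by move=> x0; apply/prodf_neq0 => i _; rewrite gt_eqF // ltr_wpDr.
Qed.

Lemma jac_norm_neq0 (R : realFieldType) (a : R) (m : nat) :
  -1 < a -> jac_norm a m != 0.
Proof.
move=> a1; rewrite mulf_neq0 ?signr_eq0 // invr_eq0 mulf_neq0 //.
  by rewrite poch_neq0 //; lra.
by rewrite pnatr_eq0 -lt0n fact_gt0.
Qed.

Lemma jac_coef_eq0 (R : fieldType) (a eps : R) (m n : nat) :
  (n < m)%N -> jac_coef a eps m n = 0.
Proof.
move=> nm; rewrite /jac_coef horner_node_poly (bigD1 (Ordinal nm)) //=.
by rewrite subrr mul0r mulr0.
Qed.

Lemma jac_coef_neq0 (R : realFieldType) (a eps : R) (n : nat) :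
  -1 < a -> 0 <= eps -> jac_coef a eps n n != 0.
Proof.
move=> a1 eps0; rewrite mulf_neq0 ?jac_norm_neq0 // horner_node_poly.
apply/prodf_neq0 => r _; rewrite subr_eq0 (inj_eq (node_inj eps0)).
by rewrite gtn_eqF.
Qed.

Lemma coef_jac_poly (R : fieldType) (a eps : R) (m n : nat) :
  (jac_poly a eps n)`_m = jac_coef a eps m n.
Proof.
rewrite coef_poly; case: ltnP => // nm.
by rewrite jac_coef_eq0.
Qed.

Lemma size_jac_poly (R : realFieldType) (a eps : R) (n : nat) :
  -1 < a -> 0 <= eps -> size (jac_poly a eps n) = n.+1.
Proof. by move=> a1 eps0; rewrite size_poly_eq // jac_coef_neq0. Qed.

(** Factor by factor, (-n + r)(n + 2 eps + r) = -(y_n - y_r); the signs are collected in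
    [jac_norm]. *)
Lemma jac_coefE (R : fieldType) (a eps : R) (m n : nat) :
  jac_coef a eps m n =
  hyp_coef [:: - n%:R; n%:R + 2 * eps] [:: a + 1] m.
Proof.
rewrite /jac_coef /jac_norm /hyp_coef !big_cons !big_nil !mulr1 mulrAC.
congr (_ / _); rewrite horner_node_poly /poch -big_split /=.
rewrite -[m in (-1) ^+ m]card_ord -prodr_const -big_split /=.
by apply: eq_bigr => r _; rewrite /node; ring.
Qed.

Lemma jacobiE (R : realType) (a b : R) (n : nat) :
  jacobi a b n = (poch (a + 1) n / n`!%:R) *:
    (jac_poly a ((a + b + 1) / 2) n \Po (2^-1 *: (1 - 'X))).
Proof.
congr (_ *: _); rewrite /jac_poly poly_def raddf_sum; apply: eq_bigr => m _ /=.
rewrite comp_polyZ comp_Xn_poly jac_coefE (_ : n%:R + 2 * _ = n%:R + a + b + 1) //.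
by field.
Qed.

(** * Quotients of alternants by the Vandermonde product *)

Lemma ueval_horner_alg (R : fieldType) (K : nat) (p : {poly R}) (s : 'I_K) :
  horner_alg ('X_s : {mpoly R[K]}) (p \Po (2^-1 *: (1 - 'X))) = ueval p s.
Proof.
rewrite /ueval /horner_alg /horner_morph.
rewrite map_comp_poly horner_comp; congr (_.[_]).
  by apply/eq_map_poly => x; rewrite /= alg_mpolyC.
rewrite map_polyZ hornerZ rmorphB /= map_polyX rmorph1 !hornerE /uvar.
by rewrite alg_mpolyC mul_mpolyC.
Qed.

Lemma jacobi_detE (R : realType) (a b : R) (N : nat) (nu : signature N) :
  jacobi_det a b nu = (\prod_i (poch (a + 1) (shifted nu i) / (shifted nu i)`!%:R)) *:
    alternant (fun i => jac_poly a ((a + b + 1) / 2) (shifted nu i)).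
Proof.
pose d := \row_(i < N) @mpolyC N R (poch (a + 1) (shifted nu i) / (shifted nu i)`!%:R).
transitivity (\det (diag_mx d *m \matrix_(i < N, s < N)
    ueval (jac_poly a ((a + b + 1) / 2) (shifted nu i)) s)).
  congr (\det _); apply/matrixP => i s; rewrite mul_diag_mx !mxE jacobiE linearZ /=.
  by rewrite ueval_horner_alg mulr_algl mul_mpolyC.
rewrite det_mulmx det_diag -mul_mpolyC rmorph_prod; congr (_ * _).
by apply: eq_bigr => i _; rewrite mxE.
Qed.

(** The quotient of the alternant by the Vandermonde product in the u_s, written with divided
    differences so that it can be specialized directly; [n] bounds the sizes of the [p i]. *)
Definition alternant_quot (R : fieldType) (K n : nat) (p : 'I_K -> {poly R}) :
    {mpoly R[K]} :=
  \det (map_mx (@mpolyC K R) (\matrix_(i < K, m < n) (p i)`_m) *m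
        newton_mx n (@uvar R K)).

(** The ratio of the Vandermonde products in u and in x, as u_i - u_j = - (x_i - x_j) / 2. *)
Definition half_prod (R : fieldType) (K : nat) : R :=
  \prod_(i < K) \prod_(j < K | (i < j)%N) (- 2^-1).

Lemma alternantE (R : realType) (K n : nat) (p : 'I_K -> {poly R}) :
  (forall i, (size (p i) <= n)%N) ->
  alternant p = half_prod R K *: (alternant_quot n p * vandermonde_prod R K).
Proof.
move=> sp; rewrite scalerAr /alternant_quot.
have -> : half_prod R K *: vandermonde_prod R K =
    \prod_(i < K) \prod_(j < K | (i < j)%N) (uvar R i - uvar R j).
  rewrite -mul_mpolyC /half_prod /vandermonde_prod rmorph_prod -big_split.
  apply: eq_bigr => i _; rewrite rmorph_prod -big_split; apply: eq_bigr => j _.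
  by rewrite /= mul_mpolyC /uvar -scalerBr scaleNr -scalerN; congr (_ *: _); ring.
rewrite det_newton; congr (\det _); apply/matrixP => i s; rewrite !mxE.
rewrite /ueval (@horner_coef_wide _ n) ?size_map_poly //.
by apply: eq_bigr => m _; rewrite !mxE coef_map.
Qed.

Lemma half_prod_neq0 (R : realType) (K : nat) : half_prod R K != 0.
Proof.
apply/prodf_neq0 => i _; apply/prodf_neq0 => j _.
by rewrite oppr_eq0 invr_eq0 pnatr_eq0.
Qed.

Lemma vandermonde_prod_neq0 (R : realType) (K : nat) : vandermonde_prod R K != 0.
Proof.
apply/prodf_neq0 => i _; apply/prodf_neq0 => j ij; rewrite subr_eq0.
apply/eqP => /(congr1 (meval (fun k => (k == i)%:R))) /eqP.
by rewrite !mevalXU eqxx -val_eqE (gtn_eqF ij) oner_eq0.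
Qed.

Lemma mjacobiE (R : realType) (a b : R) (N n : nat) (nu : signature N) :
  (forall i, (shifted nu i < n)%N) ->
  mjacobi a b nu =
  ((\prod_i (poch (a + 1) (shifted nu i) / (shifted nu i)`!%:R)) * half_prod R N) *:
   alternant_quot n (fun i => jac_poly a ((a + b + 1) / 2) (shifted nu i)).
Proof.
move=> nun; apply: (mulIf (vandermonde_prod_neq0 R N)).
set P := _ *: alternant_quot _ _.
have detE : P * vandermonde_prod R N = jacobi_det a b nu.
  rewrite jacobi_detE (@alternantE _ _ n) ?scalerA -?scalerAl // => i.
  by rewrite (leq_trans (size_poly _ _)).
(* The explicit polynomial [P] proves that a quotient exists, so the chosen one satisfies the
   defining equation too. *)
by rewrite detE; exact: (@epsilon_spec _ _ (fun Q => Q * vandermonde_prod R N = _) (ex_intro _ P detE)).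
Qed.

Lemma rev_pts_spec (A : comNzRingType) (K D : nat) (x : 'I_(K + D) -> A) :
  (forall s, x (rshift K s) = 0) ->
  (forall r, (r < D)%N -> rev_pts x r = 0) /\
  (forall r, rev_pts x (D + r) = rev_pts (fun s => x (lshift D s)) r).
Proof.
move=> x0; split=> r; rewrite /rev_pts.
  move=> rD; have rN : (r < K + D)%N by lia.
  rewrite (insubT (fun i => (i < K + D)%N) rN) /=.
  have -> : rev_ord (Ordinal rN) = rshift K (rev_ord (Ordinal rD)).
    by apply: val_inj => /=; lia.
  exact: x0.
case: insubP => [[i iN] /= iN' ir|nr]; case: insubP => [[j jK] /= jK' jr|nr'] //=.
- by congr x; apply: val_inj => /=; lia.
- by exfalso; lia.
- by exfalso; lia.
Qed.

Lemma row_mx0_det (A : comNzRingType) (D : nat) (X : 'M[A]_(0 + D, 0))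
    (M : 'M[A]_(0 + D, D)) :
  \det (row_mx X M) = \det (M : 'M_D).
Proof.
congr (\det _); apply/matrixP => i s; rewrite mxE.
case: splitP => [[]//|k /= sk]; congr (M _ _); apply: val_inj.
by rewrite /= sk.
Qed.

(** The block lemma with K = 0, where only the right-hand columns remain. *)
Lemma det_alternant (R : fieldType) (N : nat) (y : 'I_N -> R)
    (e : nat -> {poly R}) (ga : nat -> R) :
  injective y -> (forall r, e r \is monic) -> (forall r, size (e r) = r.+1) ->
  \det (\matrix_(i < N, s < N) (ga (rev_ord s) * (e (rev_ord s)).[y i])) =
  (\prod_(m < N) ga m) *
     \prod_(i < N) \prod_(j < N | (i < j)%N) (y i - y j).
Proof.
move=> yI em es.
have := @det_alternant_block R R idfun 0 N y e e ga 0 yI em es em es.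
by rewrite row_mx0_det det_mx00 mulr1.
Qed.

Lemma rmorph_alternant_quot (R : fieldType) (A : comNzRingType) (K n : nat)
    (f : {rmorphism {mpoly R[K]} -> A}) (p : 'I_K -> {poly R}) :
  f (alternant_quot n p) =
  \det (map_mx (f \o @mpolyC K R) (\matrix_(i < K, m < n) (p i)`_m) *m
        newton_mx n (fun s => f (uvar R s))).
Proof.
rewrite -det_map_mx map_mxM; congr (\det (_ *m _)).
  by apply/matrixP => i m; rewrite !mxE.
apply/matrixP => m s; rewrite !mxE rmorph_newton; apply: eq_newton => r /=.
by rewrite /rev_pts; case: insub => //=; rewrite rmorph0.
Qed.

(** At x = 1 all the points u_s are 0, so the divided differences reduce to single coefficients. *)
Lemma alternant_quot1 (R : fieldType) (K n : nat) (p : 'I_K -> {poly R}) :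
  (K <= n)%N ->
  (alternant_quot n p).@[fun=> 1] =
  \det (\matrix_(i < K, s < K) (p i)`_(rev_ord s)).
Proof.
move=> Kn; rewrite rmorph_alternant_quot; congr (\det _).
have z0 r : (r < K)%N -> rev_pts (fun s : 'I_K => (uvar R s).@[fun=> 1]) r = 0.
  rewrite /rev_pts; case: insub => //= s _.
  by rewrite mevalZ mevalB meval1 mevalXU subrr mulr0.
apply/matrixP => i s; rewrite !mxE.
have sK := ltn_ord (rev_ord s).
have sn : (rev_ord s < n)%N by rewrite (leq_trans sK).
rewrite (bigD1 (Ordinal sn)) //= !mxE /= mevalC (newton_zero _ z0) //.
rewrite eqxx mulr1 big1 ?addr0 // => m ms.
rewrite !mxE (newton_zero _ z0) // -[_ == _]/(m == Ordinal sn).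
by rewrite (negPf ms) mulr0.
Qed.

Lemma mjacobi_normalizedE (R : realType) (a b : R) (N n : nat) (nu : signature N) :
  -1 < a -> (forall i, (shifted nu i < n)%N) -> (N <= n)%N ->
  mjacobi_normalized a b nu =
  (\det (\matrix_(i < N, s < N)
      jac_coef a ((a + b + 1) / 2) (rev_ord s) (shifted nu i)))^-1 *:
   alternant_quot n (fun i => jac_poly a ((a + b + 1) / 2) (shifted nu i)).
Proof.
move=> a1 nun Nn; rewrite /mjacobi_normalized (mjacobiE a b nun) mevalZ.
set c := _ * half_prod R N.
have c0 : c != 0.
  rewrite mulf_neq0 ?half_prod_neq0 //; apply/prodf_neq0 => i _.
  rewrite mulf_neq0 ?poch_neq0 ?invr_eq0 ?pnatr_eq0 -?lt0n ?fact_gt0 //; lra.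
rewrite scalerA invfM mulrAC mulVf // mul1r alternant_quot1 //.
congr (_^-1 *: _); congr (\det _); apply/matrixP => i s.
by rewrite !mxE coef_jac_poly.
Qed.

(** The last [D] variables become u = 0 and come first in the divided differences: their own columns
    are single coefficients ([newton_zero]), and the other columns lose the first [D] coefficients
    ([newton_shift]). *)
Lemma specialize_alternant_quot (R : realType) (K D n : nat)
    (p : 'I_(K + D) -> {poly R}) :
  specialize K (alternant_quot (D + n) p) =
  \det (row_mx (map_mx (@mpolyC K R) (\matrix_(i < K + D, m < n) (p i)`_(D + m))
                 *m newton_mx n (@uvar R K))
               (\matrix_(i < K + D, s < D) ((p i)`_(rev_ord s))%:MP)).
Proof.
rewrite /specialize rmorph_alternant_quot.
set lq := mktuple _; pose x s : {mpoly R[K]} := uvar R s \mPo lq.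
rewrite (_ : newton_mx _ _ = newton_mx (D + n) x) //.
have x0 s : x (rshift K s) = 0.
  rewrite /x /uvar /= comp_mpolyZ comp_mpolyB comp_mpoly1 comp_mpolyXU -tnth_nth tnth_mktuple.
  by rewrite insubF ?subrr ?scaler0 //= ltnNge leq_addr.
have xl s : x (lshift D s) = uvar R s.
  rewrite /x /uvar /= comp_mpolyZ comp_mpolyB comp_mpoly1 comp_mpolyXU -tnth_nth tnth_mktuple.
  by rewrite /= valK.
have [z0 zD] := rev_pts_spec x0.
congr (\det _); apply/matrixP => i s; rewrite !mxE big_split_ord /=.
case: splitP => [s' ss'|s' ss'].
  have rs : rev_ord s = D + rev_ord s' :> nat.
    by rewrite /= ss'; have := ltn_ord s'; lia.
  rewrite [X in X + _]big1 ?add0r => [|m _]; last first.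
    by rewrite !mxE rs newton_shift //= ltn_ord mulr0.
  rewrite mxE; apply: eq_bigr => m _; rewrite !mxE rs newton_shift //=.
  rewrite comp_mpolyC ltnNge leq_addr addKn; congr (_ * _).
  apply: eq_newton => r; rewrite zD /rev_pts.
  by case: insub => //= ?; rewrite xl.
have rs : rev_ord s = rev_ord s' :> nat.
  by rewrite /= ss'; have := ltn_ord s'; lia.
rewrite [X in _ + X]big1 ?addr0 => [|m _]; last first.
  rewrite !mxE rs (newton_zero _ z0) //; have := ltn_ord (rev_ord s').
  by case: eqP => [/= <-|]; rewrite ?mulr0 // ltnNge leq_addr.
have sD := ltn_ord (rev_ord s').
rewrite (bigD1 (rev_ord s')) //= !mxE rs (newton_zero _ z0) //= comp_mpolyC.
rewrite eqxx mulr1 big1 ?addr0 // => m ms.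
rewrite !mxE rs (newton_zero _ z0) // -[_ == _]/(m == rev_ord s').
by rewrite (negPf ms) mulr0.
Qed.

(** * Normalized multivariate Jacobi polynomials and their specializations as alternants *)

Definition shifted_node (R : nzRingType) (eps : R) (N : nat) (nu : signature N)
    (i : 'I_N) : R := node eps (shifted nu i).

Lemma shifted_node_inj (R : realFieldType) (eps : R) (N : nat) (nu : signature N) :
  0 <= eps -> injective (shifted_node eps nu).
Proof. by move=> eps0 i j /(node_inj eps0)/shifted_inj. Qed.

Definition node_vandermonde (R : nzRingType) (eps : R) (N : nat) (nu : signature N) : R :=
  \prod_(i < N) \prod_(j < N | (i < j)%N) (shifted_node eps nu i - shifted_node eps nu j).

Lemma node_vandermonde_neq0 (R : realFieldType) (eps : R) (N : nat) (nu : signature N) :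
  0 <= eps -> node_vandermonde eps nu != 0.
Proof.
move=> eps0; apply/prodf_neq0 => i _; apply/prodf_neq0 => j ij.
by rewrite subr_eq0 (inj_eq (@shifted_node_inj _ _ _ nu eps0)) neq_ltn ij.
Qed.

Definition jac_norm_prod (R : fieldType) (a : R) (N : nat) : R :=
  \prod_(m < N) jac_norm a m.

Lemma jac_norm_prod_neq0 (R : realFieldType) (a : R) (N : nat) :
  -1 < a -> jac_norm_prod a N != 0.
Proof. by move=> a1; apply/prodf_neq0 => m _; apply: jac_norm_neq0. Qed.

Lemma det_jac_coef (R : realFieldType) (a eps : R) (N : nat) (nu : signature N) :
  0 <= eps ->
  \det (\matrix_(i < N, s < N) jac_coef a eps (rev_ord s) (shifted nu i)) =
  jac_norm_prod a N * node_vandermonde eps nu.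
Proof.
move=> eps0; apply: (det_alternant (y := shifted_node eps nu)).
- exact: shifted_node_inj.
- exact: node_poly_monic.
- exact: size_node_poly.
Qed.

(* The polynomial T_l of the header, truncated to degree < n. *)
Definition jac_tail (R : fieldType) (a eps : R) (D n l : nat) : {poly R} :=
  \poly_(m < n) jac_coef a eps (D + m) l.

(** For q = b_r this is the polynomial U_r of the overview. It is linear in [q]. *)
Definition jac_interp (R : fieldType) (a eps : R) (N : nat) (nu : signature N)
    (D n : nat) (q : {poly R}) : {poly R} :=
  \sum_i (q.[shifted_node eps nu i] * lagrange_weight (shifted_node eps nu) i) *:
    jac_tail a eps D n (shifted nu i).

Lemma jac_interp_sum (R : fieldType) (a eps : R) (N : nat) (nu : signature N)
    (D n K : nat) (c : 'I_K -> R) (q : 'I_K -> {poly R}) :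
  jac_interp a eps nu D n (\sum_r c r *: q r) =
  \sum_r c r *: jac_interp a eps nu D n (q r).
Proof.
rewrite /jac_interp; under [RHS]eq_bigr do rewrite scaler_sumr.
rewrite exchange_big; apply: eq_bigr => i _.
rewrite horner_sum mulr_suml scaler_suml; apply: eq_bigr => r _.
by rewrite scalerA hornerZ mulrA.
Qed.

Lemma size_jac_interp (R : fieldType) (a eps : R) (N : nat) (nu : signature N)
    (D n : nat) (q : {poly R}) :
  (size (jac_interp a eps nu D n q) <= n)%N.
Proof.
apply: (leq_trans (size_sum _ _ _)); apply/bigmax_leqP => i _.
by rewrite (leq_trans (size_scale_leq _ _)) // size_poly.
Qed.

Lemma alternant_lincomb (R : fieldType) (K n : nat) (M : 'M[R]_(K, n))
    (p : nat -> {poly R}) :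
  alternant (fun i => \sum_r M i r *: p r) =
  \det (map_mx (@mpolyC K R) M *m \matrix_(r < n, s < K) ueval (p r) s).
Proof.
congr (\det _); apply/matrixP => i s; rewrite !mxE /ueval rmorph_sum horner_sum.
by apply: eq_bigr => r _; rewrite !mxE /= map_polyZ hornerZ.
Qed.

Lemma alternant_mulmx (R : fieldType) (K : nat) (M : 'M[R]_K)
    (p : nat -> {poly R}) :
  alternant (fun i => \sum_r M i r *: p r) = \det M *: alternant (fun i => p i).
Proof. by rewrite alternant_lincomb det_mulmx det_map_mx mul_mpolyC. Qed.

Lemma mjacobi_normalized_alternant (R : realType) (a b : R) (K : nat)
    (kappa : signature K) :
  -1 < a -> -1 <= a + b ->
  let eps := (a + b + 1) / 2 in
  (half_prod R K *: vandermonde_prod R K) * mjacobi_normalized a b kappa =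
  (jac_norm_prod a K * node_vandermonde eps kappa)^-1 *:
    alternant (fun i => jac_poly a eps (shifted kappa i)).
Proof.
move=> a1 ab eps; have eps0 : 0 <= eps by rewrite /eps; lra.
pose n := (K + \sum_i (shifted kappa i).+1)%N.
have kn i : (shifted kappa i < n)%N.
  by rewrite /n (bigD1 i) //=; lia.
rewrite (@mjacobi_normalizedE _ _ _ _ n) ?leq_addr //.
rewrite det_jac_coef // (@alternantE _ _ n) => [|i]; last first.
  by rewrite (leq_trans (size_poly _ _)).
by rewrite -scalerAr -scalerAl scalerA [RHS]scalerA mulrC; congr (_ *: _); rewrite mulrC.
Qed.

(** The normalizing determinant and the block lemma both contribute [node_vandermonde eps nu], which
    cancels. The monic family [q] is left free so that it can be adapted to the poles of the g_k. *)
Lemma specialize_mjacobi_alternant (R : realType) (a b : R) (K D n : nat)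
    (nu : signature (K + D)) (q : nat -> {poly R}) :
  -1 < a -> -1 <= a + b ->
  (forall i, (shifted nu i < D + n)%N) -> (K <= n)%N ->
  (forall r, q r \is monic) -> (forall r, size (q r) = r.+1) ->
  let eps := (a + b + 1) / 2 in
  (half_prod R K *: vandermonde_prod R K) * specialize K (mjacobi_normalized a b nu) =
  (jac_norm_prod a D / jac_norm_prod a (K + D)) *:
    alternant (fun r : 'I_K => jac_interp a eps nu D n (q r)).
Proof.
move=> a1 ab nun Kn qm qs eps; have eps0 : 0 <= eps by rewrite /eps; lra.
rewrite (@mjacobi_normalizedE _ _ _ _ (D + n)) //; last by rewrite addnC leq_add2l.
rewrite det_jac_coef // /specialize comp_mpolyZ -/(specialize _ _).
rewrite specialize_alternant_quot (@alternantE _ _ n) => [|i]; last first.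
  exact: size_jac_interp.
set y := shifted_node eps nu.
have yI : injective y by apply: shifted_node_inj.
set X := _ *m _.
have -> : (\matrix_(i < K + D, s < D) ((jac_poly a eps (shifted nu i))`_(rev_ord s))%:MP) =
   \matrix_(i < K + D, s < D) (@mpolyC K R (jac_norm a (rev_ord s) * (node_poly eps (rev_ord s)).[y i])).
  by apply/matrixP => i s; rewrite !mxE coef_jac_poly.
rewrite (det_alternant_block (@mpolyC K R) (jac_norm a) X yI qm qs
  (node_poly_monic eps) (size_node_poly eps)).
rewrite -/(jac_norm_prod a D) -/(node_vandermonde eps nu) mul_mpolyC.
rewrite -!scalerAr -!scalerAl !scalerA mulrC.
congr (_ *: _).
  field.
  by rewrite jac_norm_prod_neq0 // node_vandermonde_neq0.
rewrite mulrC; congr (_ * _); rewrite /X mulmxA -map_mxM; congr (\det (map_mx _ _ *m _)).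
apply/matrixP => r m; rewrite !mxE coef_sum; apply: eq_bigr => i _.
by rewrite !mxE coefZ coef_jac_poly coef_poly ltn_ord.
Qed.

(** * The rational functions g_k and F_N *)

HB.instance Definition _ (R : realType) :=
  GRing.RMorphism.copy (@ratC R) (@tofrac {poly R[i]} \o @polyC R[i]).
HB.instance Definition _ (R : realType) :=
  GRing.RMorphism.copy (@ratR R) (@ratC R \o real_complex R).

Lemma rat_t_sqr_neq (R : realType) (z : R[i]) : rat_t R ^+ 2 != ratC z.
Proof.
rewrite -subr_eq0 /rat_t /ratC -rmorphXn -rmorphB /= tofrac_eq0.
by rewrite -size_poly_eq0 size_XnsubC.
Qed.

(** The image of u^m under the linear map of the overview. *)
Definition gfun_factor (R : realType) (a eps : R) (L m : nat) : ratfun R :=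
  ratR (poch L%:R m * poch (L%:R + a) m) /
  \prod_(r < m) (ratR (node eps (L + r)) - rat_t R ^+ 2).

Lemma rmorph_poch (F F' : fieldType) (f : {rmorphism F -> F'}) (x : F) (m : nat) :
  f (poch x m) = poch (f x) m.
Proof.
by rewrite rmorph_prod; apply: eq_bigr => i _; rewrite rmorphD rmorph_nat.
Qed.

(** The two denominator symbols that involve t pair up as (L + r + eps - t)(L + r + eps + t) =
    y_(L+r) - t^2; the other factors form c_m(k), which is 0 for m > k. *)
Lemma gfunE (R : realType) (a eps : R) (L k n : nat) :
  (k < n)%N ->
  gfun a eps L k = \sum_(m < n) ratR (jac_coef a eps m k) * gfun_factor a eps L m.
Proof.
move=> kn; rewrite [RHS](bigID (fun m : 'I_n => (m < k.+1)%N)) /= addrC big1 ?add0r.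
  rewrite -(big_ord_widen _ (fun m => ratR (jac_coef a eps m k) * gfun_factor a eps L m)) //.
  apply: eq_bigr => m _; rewrite jac_coefE /hyp_coef /gfun_factor.
  rewrite !big_cons !big_nil !mulr1 !rmorphM !fmorphV !rmorphM !rmorph_nat !rmorph_poch.
  rewrite rmorphN !rmorph_nat.
  have -> : \prod_(r < m) (ratR (node eps (L + r)) - rat_t R ^+ 2) =
      poch (- rat_t R + ratR (L%:R + eps)) m * poch (rat_t R + ratR (L%:R + eps)) m.
    rewrite -big_split /=; apply: eq_bigr => r _.
    by rewrite /node natrD rmorphXn !rmorphD !rmorph_nat; ring.
  rewrite !invfM; ring.
by move=> m; rewrite -leqNgt => km; rewrite jac_coef_eq0 // rmorph0 mul0r.
Qed.

(** Writing s - x = (s - y_(D+m)) + (y_(D+m) - x) turns each summand into a difference of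
    consecutive remainders. The final remainder vanishes when x is one of y_D, ..., y_(D+n-1). *)
Lemma sum_telescope (F : fieldType) (y : nat -> F) (s x : F) (D n : nat) :
  (forall m, s != y m) ->
  (s - x) * (\sum_(m < n) (\prod_(r < m) (y (D + r)%N - x)) /
              (\prod_(r < m) (y (D + r.+1)%N - s))) =
  (s - y D) - (\prod_(r < n) (y (D + r)%N - x)) /
              (\prod_(r < n) (y (D + r.+1)%N - s)) * (s - y (D + n)%N).
Proof.
move=> sy; elim: n => [|n IH].
  by rewrite !big_ord0 mulr0 divr1 mul1r addn0 subrr.
rewrite big_ord_recr /= mulrDr {}IH !big_ord_recr /= -!addrA; congr (_ + _).
set P := \prod_(r < n) _; set Q := \prod_(r < n) _.
have Q0 : Q != 0.
  by apply/prodf_neq0 => r _; rewrite subr_eq0 eq_sym.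
have yn : y (D + n.+1)%N - s != 0 by rewrite subr_eq0 eq_sym.
by field; rewrite Q0 yn.
Qed.

Lemma pochD (F : fieldType) (x : F) (m n : nat) :
  poch x (m + n) = poch x m * poch (x + m%:R) n.
Proof.
rewrite /poch big_split_ord; congr (_ * _); apply: eq_bigr => i _ /=.
by rewrite natrD addrA.
Qed.

Lemma factD_poch (R : realFieldType) (m n : nat) :
  ((m + n)`!%:R : R) = m`!%:R * poch (m + 1)%N%:R n.
Proof.
elim: n => [|n IH]; first by rewrite addn0 /poch big_ord0 mulr1.
rewrite addnS factS natrM IH /poch big_ord_recr /= mulrCA; congr (_ * _).
by rewrite mulrC -natrD; congr (_ * _%:R); lia.
Qed.

(** With L = D + 1, (a+1)_(D+m) = (a+1)_D (L+a)_m and (D+m)! = D! (L)_m, so the numerator symbols of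
    [gfun_factor] cancel exactly. *)
Lemma jac_norm_shift (R : realFieldType) (a : R) (D m : nat) :
  -1 < a ->
  jac_norm a (D + m) * (poch (D + 1)%N%:R m * poch ((D + 1)%N%:R + a) m) =
  jac_norm a D * (-1) ^+ m.
Proof.
move=> a1; rewrite /jac_norm exprD pochD factD_poch.
have -> : (D + 1)%N%:R + a = a + 1 + D%:R by rewrite natrD; ring.
have a0 : 0 < a + 1 by lra.
have h1 : poch (a + 1) D != 0 by rewrite poch_neq0.
have h2 : poch (a + 1 + D%:R) m != 0 by rewrite poch_neq0 // ltr_wpDr ?ler0n.
have h3 : poch (D + 1)%N%:R m != 0 :> R by rewrite poch_neq0 // ltr0n addn1.
have h4 : D`!%:R != 0 :> R by rewrite pnatr_eq0 -lt0n fact_gt0.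
by field; rewrite h1 h2 h3 h4.
Qed.

(** * The linear map sending J_k to g_k, and the images of the tails *)

Definition gfun_map (R : realType) (a eps : R) (L n : nat) (p : {poly R}) : ratfun R :=
  \sum_(m < n) ratR p`_m * gfun_factor a eps L m.

Lemma gfun_map_sum (R : realType) (a eps : R) (L n : nat) (I : Type) (r : seq I)
    (c : I -> R) (p : I -> {poly R}) :
  gfun_map a eps L n (\sum_(i <- r) c i *: p i) =
  \sum_(i <- r) ratR (c i) * gfun_map a eps L n (p i).
Proof.
rewrite /gfun_map; under [RHS]eq_bigr do rewrite mulr_sumr.
rewrite exchange_big; apply: eq_bigr => m _.
rewrite coef_sum rmorph_sum mulr_suml; apply: eq_bigr => i _.
by rewrite coefZ rmorphM mulrA.
Qed.

Lemma gfun_map_jac_poly (R : realType) (a eps : R) (L n k : nat) :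
  (k < n)%N -> gfun_map a eps L n (jac_poly a eps k) = gfun a eps L k.
Proof.
move=> kn; rewrite (gfunE _ _ _ kn); apply: eq_bigr => m _.
by rewrite coef_jac_poly.
Qed.

(** For l < D both sides vanish with e_D(y_l); otherwise the telescoping sum applies with x =
    y_l. *)
Lemma gfun_map_jac_tail (R : realType) (a eps : R) (D n l : nat) :
  -1 < a -> (l < D + n)%N ->
  gfun_map a eps (D + 1) n (jac_tail a eps D n l) =
  ratR (jac_norm a D * (node_poly eps D).[node eps l]) *
    ((rat_t R ^+ 2 - ratR (node eps D)) / (rat_t R ^+ 2 - ratR (node eps l))).
Proof.
move=> a1 lDn; set s := rat_t R ^+ 2.
pose y m := ratR (node eps m).
have sy m : s != y m by apply: rat_t_sqr_neq.
have sum : \sum_(m < n) (\prod_(r < m) (y (D + r)%N - y l)) /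
      (\prod_(r < m) (y (D + r.+1)%N - s)) * ratR (node_poly eps D).[node eps l] =
    ratR (node_poly eps D).[node eps l] * ((s - y D) / (s - y l)).
  rewrite -mulr_suml mulrC; case: (ltnP l D) => lD.
    by rewrite horner_node_poly (bigD1 (Ordinal lD)) //= subrr mul0r rmorph0 !mul0r.
  have := sum_telescope (y l) D n sy.
  have ln : (l - D < n)%N by lia.
  (* The factor r = l - D kills the remainder; it occurs in the product because l < D + n. *)
  rewrite (bigD1 (Ordinal ln) (F := fun r : 'I_n => y (D + r)%N - y l)) //= subnKC // subrr !mul0r subr0.
  by move=> <-; rewrite [(s - _) * _]mulrC mulfK // subr_eq0.
rewrite rmorphM -mulrA -{}sum mulr_sumr; apply: eq_bigr => m _.
rewrite coef_poly ltn_ord /jac_coef /gfun_factor.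
have -> : \prod_(r < m) (ratR (node eps (D + 1 + r)) - rat_t R ^+ 2) =
    \prod_(r < m) (y (D + r.+1)%N - s).
  by apply: eq_bigr => r _; rewrite addn1 addSnnS.
have -> : \prod_(r < m) (y (D + r)%N - y l) =
    ratR ((-1) ^+ m * \prod_(r < m) (node eps l - node eps (D + r))).
  rewrite -[m in (-1) ^+ m]card_ord -prodr_const -big_split rmorph_prod /=.
  by apply: eq_bigr => r _; rewrite mulN1r opprB rmorphB.
rewrite !horner_node_poly big_split_ord /=.
rewrite mulrA -(rmorphM (@ratR R)) [in RHS]mulrAC -(rmorphM (@ratR R)).
rewrite [RHS]mulrA -(rmorphM (@ratR R)).
congr (ratR _ / _).
set E := \prod_(i < D) _; set P := \prod_(i < m) _.
transitivity (E * P * (jac_norm a (D + m) *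
  (poch (D + 1)%N%:R m * poch ((D + 1)%N%:R + a) m))); first by ring.
by rewrite jac_norm_shift //; ring.
Qed.

(** * The products g_(K-j) F_N as images of combinations of the U_r *)

Lemma FNE (R : realType) (N : nat) (nu : signature N) (eps : R) :
  FN nu eps = (map_poly (@ratR R) (node_poly eps N)).[rat_t R ^+ 2] /
    \prod_i (rat_t R ^+ 2 - ratR (shifted_node eps nu i)).
Proof.
rewrite /FN prodf_div; congr (_ / _); last first.
  by apply: eq_bigr => i _; rewrite /shifted_node /node rmorphXn.
rewrite rmorph_prod horner_prod (reindex_inj rev_ord_inj); apply: eq_bigr => i _ /=.
rewrite map_polyXsubC hornerXsubC /node rmorphXn.
have -> : (N - (N - i.+1).+1 = i)%N by have := ltn_ord i; lia.
by [].
Qed.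

(* The product of the factors y - A_m^2 for m = K-r, ..., K-1, where L = D+1. *)
Definition pole_poly (R : nzRingType) (eps : R) (K D r : nat) : {poly R} :=
  \prod_(p < r) ('X - (node eps (D + 1 + (K.-1 - r) + p))%:P).

Lemma pole_poly_monic (R : nzRingType) (eps : R) (K D r : nat) :
  pole_poly eps K D r \is monic.
Proof. by apply: monic_prod => i _; apply: monicXsubC. Qed.

Lemma size_pole_poly (R : idomainType) (eps : R) (K D r : nat) :
  size (pole_poly eps K D r) = r.+1.
Proof. by rewrite /pole_poly size_prod_XsubC /index_enum -enumT size_enum_ord. Qed.

(** The contribution of the term of index [m] of g_k once denominators are cleared; the sign comes
    from passing from y - t^2 to t^2 - y. *)
Definition gfun_num_coef (R : fieldType) (a eps : R) (D k m : nat) : R :=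
  jac_coef a eps m k *
  ((-1) ^+ m * (poch (D + 1)%N%:R m * poch ((D + 1)%N%:R + a) m)).

(** The denominator of index [m] is, up to sign, the product of the first [m] factors of the full
    pole polynomial; the K-1-m factors left form another [pole_poly]. *)
Lemma gfun_factor_pole_poly (R : realType) (a eps : R) (K D m : nat) :
  (m < K)%N ->
  gfun_factor a eps (D + 1) m *
    (map_poly (@ratR R) (pole_poly eps K D K.-1)).[rat_t R ^+ 2] =
  ratR ((-1) ^+ m * (poch (D + 1)%N%:R m * poch ((D + 1)%N%:R + a) m)) *
    (map_poly (@ratR R) (pole_poly eps K D (K.-1 - m))).[rat_t R ^+ 2].
Proof.
move=> mK; set s := rat_t R ^+ 2.
have evalE r : (map_poly (@ratR R) (pole_poly eps K D r)).[s] =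
    \prod_(p < r) (s - ratR (node eps (D + 1 + (K.-1 - r) + p))).
  rewrite rmorph_prod horner_prod; apply: eq_bigr => p _ /=.
  by rewrite map_polyXsubC hornerXsubC.
rewrite !evalE subnn addn0 subKn; last by lia.
have -> : \prod_(p < K.-1) (s - ratR (node eps (D + 1 + p))) =
   \prod_(p < m) (s - ratR (node eps (D + 1 + p))) *
   \prod_(p < K.-1 - m) (s - ratR (node eps (D + 1 + m + p))).
  have -> : (K.-1 = m + (K.-1 - m))%N by lia.
  rewrite big_split_ord /= addKn; congr (_ * _).
  by apply: eq_bigr => p _; rewrite addnA.
rewrite mulrA; congr (_ * _); rewrite /gfun_factor -mulrA mulrC [RHS]rmorphM.
congr (_ * _); rewrite rmorphXn rmorphN1.
have -> : \prod_(p < m) (s - ratR (node eps (D + 1 + p))) =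
    (-1) ^+ m * \prod_(r < m) (ratR (node eps (D + 1 + r)) - s).
  rewrite -[m in (-1) ^+ m]card_ord -prodr_const -big_split /=.
  by apply: eq_bigr => r _; rewrite mulN1r opprB.
rewrite mulrC mulfK //; apply/prodf_neq0 => r _.
by rewrite subr_eq0 eq_sym rat_t_sqr_neq.
Qed.

Lemma gfun_pole_poly (R : realType) (a eps : R) (K D k : nat) :
  (k < K)%N ->
  gfun a eps (D + 1) k *
    (map_poly (@ratR R) (pole_poly eps K D K.-1)).[rat_t R ^+ 2] =
  (map_poly (@ratR R) (\sum_(r < K)
    gfun_num_coef a eps D k (rev_ord r) *: pole_poly eps K D r)).[rat_t R ^+ 2].
Proof.
move=> kK; rewrite (gfunE _ _ _ kK) mulr_suml rmorph_sum horner_sum.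
rewrite (reindex_inj rev_ord_inj); apply: eq_bigr => r _.
have rK := ltn_ord r.
rewrite -mulrA gfun_factor_pole_poly ?ltn_ord // mulrA -rmorphM /= map_polyZ hornerZ.
by congr (_ * (map_poly _ (pole_poly _ _ _ _)).[_]); lia.
Qed.

(** The images of the tails are the simple fractions in the partial fraction expansion of q e_D,
    whose degree is below K + D. *)
Lemma gfun_map_jac_interp (R : realType) (a eps : R) (K D n : nat)
    (nu : signature (K + D)) (q : {poly R}) :
  -1 < a -> 0 <= eps -> (forall i, (shifted nu i < D + n)%N) -> (size q <= K)%N ->
  gfun_map a eps (D + 1) n (jac_interp a eps nu D n q) =
  ratR (jac_norm a D) * (rat_t R ^+ 2 - ratR (node eps D)) *
   (map_poly (@ratR R) (q * node_poly eps D)).[rat_t R ^+ 2] /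
   \prod_i (rat_t R ^+ 2 - ratR (shifted_node eps nu i)).
Proof.
move=> a1 eps0 nun sq; rewrite gfun_map_sum -mulrA.
have yI : injective (shifted_node eps nu) by apply: shifted_node_inj.
rewrite (lagrange_frac yI) => [||i]; last exact: rat_t_sqr_neq.
  rewrite mulr_sumr; apply: eq_bigr => i _; rewrite gfun_map_jac_tail //.
  rewrite hornerM !rmorphM /shifted_node; ring.
have [->|q0] := eqVneq q 0; first by rewrite mul0r size_poly0.
by rewrite size_Mmonic ?node_poly_monic // size_node_poly addnS /= leq_add2r.
Qed.

(** The numerator of F_N thus supplies both the factor e_D(y)(y - y_D) produced by the tails and the
    factor that clears the poles of g_(K-j). *)
Lemma node_poly_pole_poly (R : nzRingType) (eps : R) (K D : nat) :
  node_poly eps (K.+1 + D) =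
  node_poly eps D * ('X - (node eps D)%:P) * pole_poly eps K.+1 D K.
Proof.
rewrite addSnnS addnC /node_poly big_split_ord big_ord_recr /=; congr (_ * _).
by apply: eq_bigr => p _; rewrite subnn addn0 addn1.
Qed.

(** Row [j] lists the coordinates of the preimage of g_(K-j) F_N on the U_r built from [pole_poly].
    The matrix is triangular since c_m(k) = 0 for m > k. *)
Definition gfun_mx (R : fieldType) (a eps : R) (K D : nat) : 'M[R]_K :=
  \matrix_(j < K, r < K)
    ((jac_norm a D)^-1 * gfun_num_coef a eps D (rev_ord j) (rev_ord r)).

Lemma gfun_mul_FN (R : realType) (a eps : R) (K D n : nat)
    (nu : signature (K + D)) (j : 'I_K) :
  -1 < a -> 0 <= eps -> (forall i, (shifted nu i < D + n)%N) ->
  gfun a eps (D + 1) (rev_ord j) * FN nu eps =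
  gfun_map a eps (D + 1) n (\sum_(r < K) gfun_mx a eps K D j r *:
    jac_interp a eps nu D n (pole_poly eps K D r)).
Proof.
move=> a1 eps0 nun; rewrite -jac_interp_sum gfun_map_jac_interp //; last first.
  apply: (leq_trans (size_sum _ _ _)); apply/bigmax_leqP => r _.
  by rewrite (leq_trans (size_scale_leq _ _)) // size_pole_poly.
set s := rat_t R ^+ 2.
have -> : \sum_r gfun_mx a eps K D j r *: pole_poly eps K D r =
   (jac_norm a D)^-1 *: \sum_(r < K)
     gfun_num_coef a eps D (rev_ord j) (rev_ord r) *: pole_poly eps K D r.
  by rewrite scaler_sumr; apply: eq_bigr => r _; rewrite mxE scalerA.
rewrite -scalerAl map_polyZ hornerZ [map_poly _ (_ * _)]rmorphM hornerM -gfun_pole_poly ?ltn_ord //.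
rewrite FNE mulrA; congr (_ / _).
case: K nu j nun => [_ []//|K] nu j nun.
rewrite node_poly_pole_poly !(rmorphM (map_poly (@ratR R))) /= !hornerM map_polyXsubC hornerXsubC -/s /=.
have g0 : ratR (jac_norm a D) != 0 by rewrite fmorph_eq0 jac_norm_neq0.
have alg (F : fieldType) (x g e t p : F) :
    x != 0 -> g * (e * t * p) = x * t * (x^-1 * (g * p * e)) by move=> x0; field.
rewrite fmorphV; exact: alg.
Qed.

(** * The space F(eps, L) *)

Lemma regular_atD (R : realType) (z : R[i]) (f g : ratfun R) :
  regular_at z f -> regular_at z g -> regular_at z (f + g).
Proof.
move=> [p [q [qz ->]]] [p' [q' [qz' ->]]]; exists (p * q' + p' * q), (q * q').
rewrite hornerM mulf_neq0 // rmorphD !rmorphM /=; split=> //.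
have q0 : tofrac q != 0 by rewrite tofrac_eq0; apply: contraNneq qz => ->; rewrite horner0.
have q0' : tofrac q' != 0 by rewrite tofrac_eq0; apply: contraNneq qz' => ->; rewrite horner0.
by rewrite addf_div; [reflexivity | exact: q0 | exact: q0'].
Qed.

Lemma regular_atM (R : realType) (z : R[i]) (f g : ratfun R) :
  regular_at z f -> regular_at z g -> regular_at z (f * g).
Proof.
move=> [p [q [qz ->]]] [p' [q' [qz' ->]]]; exists (p * p'), (q * q').
by rewrite hornerM mulf_neq0 // !rmorphM mulf_div.
Qed.

Lemma regular_at_tofrac (R : realType) (z : R[i]) (p : {poly R[i]}) :
  regular_at z (tofrac p).
Proof. by exists p, 1; rewrite hornerC oner_eq0 rmorph1 divr1. Qed.

Lemma comp_poly_oppX_neq0 (F : fieldType) (q : {poly F}) :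
  q != 0 -> q \Po - 'X != 0.
Proof. by rewrite -!size_poly_eq0 size_comp_poly2 // size_polyN size_polyX. Qed.

Lemma calFD (R : realType) (eps : R) (L : nat) (f g : ratfun R) :
  calF eps L f -> calF eps L g -> calF eps L (f + g).
Proof.
move=> [[p [q [q0 fE fE']]] [u [v [v0 uv fE2]]] fz].
move=> [[p' [q' [q0' gE gE']]] [u' [v' [v0' uv' gE2]]] gz]; split.
- exists (p * q' + p' * q), (q * q'); split; first by rewrite mulf_neq0.
    by rewrite fE gE rmorphD !rmorphM /= addf_div ?tofrac_eq0.
  by rewrite fE' gE' !rmorphD !rmorphM /= addf_div ?tofrac_eq0 ?comp_poly_oppX_neq0.
- exists (u * v' + u' * v), (v * v'); split; first by rewrite mulf_neq0.
    rewrite (leq_trans (size_polyD _ _)) // geq_max (size_mul v0 v0').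
    have mul_le (x y : {poly R[i]}) m : (size x + size y <= m)%N ->
        (size (x * y)%R <= m.-1)%N.
      by have := size_polyMleq x y; lia.
    by rewrite !mul_le // ?leq_add2r // addnC leq_add2l.
  by rewrite fE2 gE2 rmorphD !rmorphM /= addf_div ?tofrac_eq0.
(* Multiplication by t - z preserves regularity at z, so a regular summand can be added to one with
   a simple pole. *)
move=> z; have tz h : regular_at z h -> regular_at z ((rat_t R - ratC z) * h).
  apply: regular_atM; rewrite /rat_t /ratC -rmorphB; apply: regular_at_tofrac.
case: (fz z) => [fr|[pz fr]]; case: (gz z) => [gr|[pz' gr]].
- by left; apply: regular_atD.
- by right; split=> //; rewrite mulrDr; apply: regular_atD => //; apply: tz.
- by right; split=> //; rewrite mulrDr; apply: regular_atD => //; apply: tz.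
- by right; split=> //; rewrite mulrDr; apply: regular_atD.
Qed.

Lemma calF_cst (R : realType) (eps : R) (L : nat) (c : R[i]) : calF eps L (ratC c).
Proof.
split.
- by exists c%:P, 1; rewrite oner_neq0 !comp_polyC /= rmorph1 divr1.
- by exists c%:P, 1; rewrite oner_neq0 rmorph1 divr1 size_poly1 size_polyC; case: eqP.
by move=> z; left; apply: regular_at_tofrac.
Qed.

Lemma calFZ (R : realType) (eps : R) (L : nat) (c : R[i]) (f : ratfun R) :
  calF eps L f -> calF eps L (ratC c * f).
Proof.
move=> [[p [q [q0 fE fE']]] [u [v [v0 uv fE2]]] fz]; split.
- exists (c%:P * p), q; split=> //; first by rewrite fE rmorphM mulrA.
  by rewrite fE' !rmorphM /= comp_polyC mulrA.
- exists (c%:P * u), v; split=> //; last by rewrite fE2 rmorphM mulrA.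
  by rewrite mul_polyC (leq_trans (size_scale_leq _ _)).
have cz z : regular_at z (ratC c) by apply: regular_at_tofrac.
move=> z; case: (fz z) => [fr|[pz fr]]; first by left; apply: regular_atM.
by right; split=> //; rewrite mulrCA; apply: regular_atM.
Qed.

(** The only possible poles are l + eps = A_(l-D) and its opposite; D < l makes the index positive,
    and l + eps > 0 makes the two points distinct, hence the poles simple. *)
Lemma calF_frac (R : realType) (eps : R) (D l : nat) (c : R) :
  0 <= eps -> (D < l)%N ->
  calF eps (D + 1)
    ((rat_t R ^+ 2 - ratR c) / (rat_t R ^+ 2 - ratR (node eps l))).
Proof.
move=> eps0 Dl; set y := node eps l.
pose P (x : R) : {poly R[i]} := 'X^2 - (x%:C)%:P.
have PE x : tofrac (P x) = rat_t R ^+ 2 - ratR x.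
  by rewrite /P rmorphB rmorphXn.
have P0 x : P x != 0 by rewrite -size_poly_eq0 size_XnsubC.
have Peven x : P x \Po - 'X = P x.
  by rewrite /P rmorphB /= comp_Xn_poly comp_polyC sqrrN.
split.
- by exists (P c), (P y); split; rewrite ?Peven ?PE.
- by exists (P c), (P y); split; rewrite ?PE // !size_XnsubC.
move=> z; have [Pz|Pz] := eqVneq (P y).[z] 0; last first.
  by left; exists (P c), (P y); rewrite !PE.
have z2 : z ^+ 2 = y%:C.
  by apply/eqP; rewrite -subr_eq0 -Pz /P !hornerE.
have z0 : z != 0.
  rewrite -sqrf_eq0 z2 fmorph_eq0 sqrf_eq0.
  by rewrite gt_eqF // ltr_wpDr // ltr0n; lia.
right; split.
  exists (l - D)%N; first by lia.
  have -> : pole eps (D + 1) (l - D) = (l%:R + eps)%:C.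
    by rewrite /pole natrB ?natrD 1?ltnW //; congr (_%:C); ring.
  have : (z - (l%:R + eps)%:C) * (z + (l%:R + eps)%:C) = 0.
    by rewrite -subr_sqr z2 /y /node rmorphXn subrr.
  by move/eqP; rewrite mulf_eq0 subr_eq0 addr_eq0 => /orP[]/eqP; [left|right].
(* The factor t - z cancels in t^2 - z^2, leaving t + z, whose value at z is 2z. *)
exists (P c), ('X + z%:P); rewrite hornerD hornerX hornerC -mulr2n mulrn_eq0 negb_or z0.
split=> //.
have fact : tofrac (P y) = (rat_t R - ratC z) * tofrac ('X + z%:P).
  rewrite /rat_t /ratC -rmorphB -rmorphM /P -z2; congr tofrac.
  by rewrite rmorphXn /= subr_sqr.
have nz : rat_t R - ratC z != 0.
  rewrite /rat_t /ratC -rmorphB tofrac_eq0; by rewrite polyXsubC_eq0.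
have alg (F : fieldType) (x c' d : F) : x != 0 -> x * (c' / (x * d)) = c' / d.
  by move=> x0; rewrite mulrA -mulf_div divff ?mul1r.
rewrite -!PE fact; exact: alg.
Qed.

(** Membership is read off the expansion into simple fractions: for a shifted entry l of [nu], the
    term is 0 if l < D, constant if l = D, and covered by [calF_frac] if l > D. *)
Lemma calF_gfun_mul_FN (R : realType) (a eps : R) (K D : nat)
    (nu : signature (K + D)) (j : 'I_K) :
  -1 < a -> 0 <= eps ->
  calF eps (D + 1) (gfun a eps (D + 1) (rev_ord j) * FN nu eps).
Proof.
move=> a1 eps0; pose n := (\sum_i (shifted nu i).+1)%N.
have nun i : (shifted nu i < D + n)%N by rewrite /n (bigD1 i) //=; lia.
rewrite (gfun_mul_FN _ a1 eps0 nun) -jac_interp_sum gfun_map_sum.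
apply: (big_ind (calF eps (D + 1))) => [|f g|i _].
- by rewrite -(rmorph0 (@ratC R)); apply: calF_cst.
- exact: calFD.
apply: calFZ; rewrite gfun_map_jac_tail //; set l := shifted nu i.
have [lD|Dl|->] := ltngtP l D.
- rewrite horner_node_poly (bigD1 (Ordinal lD)) //= subrr mul0r mulr0 rmorph0 mul0r.
  by rewrite -(rmorph0 (@ratC R)); apply: calF_cst.
- by apply: calFZ; apply: calF_frac.
rewrite divff ?mulr1; last by rewrite subr_eq0 rat_t_sqr_neq.
exact: calF_cst.
Qed.

Lemma horner_rat_t_sqr (R : realType) (p : {poly R[i]}) :
  (map_poly (@ratC R) p).[rat_t R ^+ 2] = tofrac (p \Po 'X^2).
Proof.
rewrite /comp_poly -horner_map /= rmorphXn -map_poly_comp.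
by congr (_.[_]); apply: eq_map_poly.
Qed.

(* At y = A_n^2 every pole_poly eps n.+1 D r with r > 0 vanishes, which isolates
   the coefficient of g_n. *)
Lemma gfun_free (R : realType) (a eps : R) (D n : nat) (c : nat -> R[i]) :
  -1 < a -> 0 <= eps ->
  \sum_(k < n) ratC (c k) * gfun a eps (D + 1) k = 0 ->
  forall k, (k < n)%N -> c k = 0.
Proof.
move=> a1 eps0; elim: n => [|n IH] // sum0.
pose Q k := \sum_(r < n.+1)
  gfun_num_coef a eps D k (rev_ord r) *: pole_poly eps n.+1 D r.
have Qk k : (Q k).[node eps (D + n)] = gfun_num_coef a eps D k n.
  rewrite /Q horner_sum (bigD1 ord0) //= subn1 /= hornerZ /pole_poly big_ord0.
  rewrite hornerC mulr1 big1 ?addr0 // => -[[|r] rn] // _.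
  rewrite hornerZ horner_prod (bigD1 (Ordinal (ltnSn r))) //= hornerXsubC.
  have -> : (D + 1 + (n - r.+1) + r = D + n)%N by rewrite /= in rn; lia.
  by rewrite subrr mul0r mulr0.
(* Clearing denominators gives a polynomial identity in t^2, hence one in y, because composition
   with X^2 is injective. *)
have sumQ0 : \sum_(k < n.+1) c k *: map_poly (real_complex R) (Q k) = 0.
  apply/eqP; rewrite -(@comp_poly_eq0 _ _ 'X^2) ?size_polyXn //.
  rewrite -tofrac_eq0 -horner_rat_t_sqr rmorph_sum horner_sum; apply/eqP.
  transitivity ((\sum_(k < n.+1) ratC (c k) * gfun a eps (D + 1) k) *
    (map_poly (@ratR R) (pole_poly eps n.+1 D n)).[rat_t R ^+ 2]); last first.
    by rewrite sum0 mul0r.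
  rewrite mulr_suml; apply: eq_bigr => k _.
  rewrite /= map_polyZ hornerZ -map_poly_comp -mulrA.
  have /= -> := @gfun_pole_poly R a eps n.+1 D k (ltn_ord k).
  reflexivity.
have cn0 : c n = 0.
  have /(congr1 (horner^~ (node eps (D + n))%:C)) := sumQ0.
  rewrite horner_sum horner0 big_ord_recr /= big1 => [|k _]; last first.
    rewrite hornerZ horner_map /= Qk /gfun_num_coef jac_coef_eq0 //.
    by rewrite mul0r mulr0.
  rewrite add0r hornerZ horner_map /= Qk => /eqP; rewrite mulf_eq0 => /orP[/eqP //|].
  rewrite fmorph_eq0; apply: contraTeq => _; rewrite /gfun_num_coef.
  rewrite mulf_neq0 ?jac_coef_neq0 // mulf_neq0 ?signr_eq0 // mulf_neq0 //.
    by apply: poch_neq0; rewrite ltr0n addn1.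
  apply: poch_neq0; rewrite natrD.
  by have : 0 <= D%:R :> R := ler0n _ _; lra.
move=> k; rewrite ltnS leq_eqVlt => /orP[/eqP -> //|]; apply: IH.
move: sum0; rewrite big_ord_recr /= cn0 rmorph0 mul0r addr0 => sum0.
exact: sum0.
Qed.

(** The given coefficients show that the choice in [gcoef] is not the default one; [gfun_free] then
    identifies the two families. *)
Lemma gcoefP (R : realType) (a eps : R) (D n : nat) (f : ratfun R) (g : nat -> R) :
  -1 < a -> 0 <= eps -> calF eps (D + 1) f ->
  f = \sum_(k < n) ratR (g k) * gfun a eps (D + 1) k ->
  forall k, (k < n)%N -> gcoef a eps (D + 1) f k = (g k)%:C.
Proof.
move=> a1 eps0 fF fE k kn.
pose d k : R[i] := if (k < n)%N then (g k)%:C else 0.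
have dE : expansion (@ratC R) (gfun a eps (D + 1)) f d.
  exists (iota 0 n); split; first exact: iota_uniq.
    by move=> m; rewrite mem_iota /= add0n /d => /negPf ->.
  rewrite fE -[n in iota _ n]subn0 -/(index_iota 0 n) big_mkord; apply: eq_bigr => m _.
  by rewrite /d ltn_ord.
pose P c := calF eps (D + 1) f /\ expansion (@ratC R) (gfun a eps (D + 1)) f c.
have [_ [s [us s0 sE]]] : P (gcoef a eps (D + 1) f).
  exact: (@epsilon_spec _ _ P (ex_intro P d (conj fF dE))).
set c := gcoef _ _ _ _ in s0 sE *.
(* A range containing both the given indices and the support of the chosen family. *)
pose M := (n + \sum_(m <- s) m.+1)%N.
have sM m : m \in s -> (m < M)%N.
  by move=> ms; rewrite /M (big_rem m) //=; lia.
have cE : f = \sum_(m < M) ratC (c m) * gfun a eps (D + 1) m.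
  rewrite sE -(big_mkord xpredT (fun m => ratC (c m) * gfun a eps (D + 1) m)).
  rewrite [RHS](bigID (mem s)) /= [X in _ + X]big1 => [|m ms]; last first.
    by rewrite s0 // rmorph0 mul0r.
  rewrite addr0 -[RHS]big_filter; apply: perm_big; apply: uniq_perm => //.
    by rewrite filter_uniq // iota_uniq.
  move=> m; rewrite mem_filter mem_index_iota /=.
  by case: (boolP (m \in s)) => //= /sM ->.
have fM : f = \sum_(m < M) ratC (d m) * gfun a eps (D + 1) m.
  rewrite fE (big_ord_widen M (fun m => ratR (g m) * gfun a eps (D + 1) m)) ?leq_addr //.
  rewrite big_mkcond; apply: eq_bigr => m _; rewrite /d.
  case: ifP => _; first by reflexivity.
  by rewrite rmorph0 mul0r.
have := @gfun_free R a eps D M (fun m => c m - d m) a1 eps0.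
have -> : \sum_(m < M) ratC (c m - d m) * gfun a eps (D + 1) m = 0.
  under eq_bigr do rewrite rmorphB mulrBl.
  by rewrite sumrB -cE -fM subrr.
move=> /(_ erefl k); rewrite /d kn => H; apply/eqP; rewrite -subr_eq0; apply/eqP.
by apply: H; rewrite /M; lia.
Qed.

(** * The determinantal formula *)

Lemma poly_basis_expand (F : fieldType) (J : nat -> {poly F}) (n : nat) (p : {poly F}) :
  (forall k, size (J k) = k.+1) -> (size p <= n)%N ->
  exists g : nat -> F, p = \sum_(k < n) g k *: J k.
Proof.
move=> sJ; elim: n p => [|n IH] p sp.
  exists (fun=> 0); rewrite big_ord0; apply/eqP.
  by rewrite -size_poly_eq0 -leqn0.
have Jn : (J n)`_n != 0.
  by rewrite -[X in _`_X]/(n.+1.-1) -(sJ n) -lead_coefE lead_coef_eq0 -size_poly_eq0 sJ.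
have [|g gE] := IH (p - (p`_n / (J n)`_n) *: J n).
  apply/leq_sizeP => m; rewrite leq_eqVlt => /orP[/eqP <-|nm].
    by rewrite coefB coefZ mulfVK // subrr.
  rewrite coefB coefZ (nth_default 0 (leq_trans sp nm)) [(J n)`_m]nth_default ?sJ //.
  by rewrite mulr0 subrr.
exists (fun k => if (k < n)%N then g k else p`_n / (J n)`_n).
rewrite big_ord_recr /= ltnn -[LHS](subrK ((p`_n / (J n)`_n) *: J n)) gE.
by congr (_ + _); apply: eq_bigr => k _; rewrite ltn_ord.
Qed.

(** On the diagonal of the triangular matrix, [jac_norm_shift] absorbs the Pochhammer symbols and
    the two signs cancel. *)
Lemma det_gfun_mx (R : realFieldType) (a eps : R) (K D : nat) :
  -1 < a ->
  \det (gfun_mx a eps K D) * jac_norm_prod a (K + D) =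
  jac_norm_prod a D * jac_norm_prod a K *
    \prod_(k < K) (node_poly eps k).[node eps k].
Proof.
move=> a1; rewrite -det_tr det_trig; last first.
  apply/is_trig_mxP => r j rj; rewrite !mxE /gfun_num_coef jac_coef_eq0.
    by rewrite mul0r mulr0.
  by have := ltn_ord j; rewrite /=; lia.
rewrite (reindex_inj rev_ord_inj) /jac_norm_prod addnC big_split_ord /= mulrCA.
rewrite -!mulrA; congr (_ * _); rewrite -!big_split /=; apply: eq_bigr => k _.
have g0 := jac_norm_neq0 D a1.
rewrite !mxE rev_ordK /gfun_num_coef /jac_coef.
set P := poch _ _ * poch _ _; set e := _.[_].
transitivity ((jac_norm a D)^-1 * (jac_norm a k * e * (-1) ^+ k) *
  (jac_norm a (D + k) * P)); first by ring.
rewrite jac_norm_shift //.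
transitivity (jac_norm a k * e * ((-1) ^+ k * (-1) ^+ k)); first by field.
by rewrite -expr2 sqrr_sign mulr1.
Qed.

(** The denominator of d_K is the node Vandermonde of the zero signature, regrouped in reverse order
    as the product of the e_k(y_k). *)
Lemma dKE (R : realType) (K : nat) (kappa : signature K) (eps : R) :
  dK kappa eps = node_vandermonde eps kappa /
    \prod_(k < K) (node_poly eps k).[node eps k].
Proof.
rewrite /dK; under eq_bigr do rewrite prodf_div.
rewrite prodf_div; congr (_ / _).
rewrite (reindex_inj rev_ord_inj); apply: eq_bigr => k _.
rewrite horner_node_poly (reindex_inj rev_ord_inj) /=.
rewrite (big_ord_widen K (fun r => node eps k - node eps r)) 1?ltnW //.
have rr (i : 'I_K) : (K - (K - i.+1).+1 = i)%N by have := ltn_ord i; lia.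
apply: eq_big => [r|r _]; last by rewrite !rr.
by have := ltn_ord k; have := ltn_ord r; lia.
Qed.

Lemma prod_node_poly_neq0 (R : realFieldType) (eps : R) (K : nat) :
  0 <= eps -> \prod_(k < K) (node_poly eps k).[node eps k] != 0.
Proof.
move=> eps0; apply/prodf_neq0 => k _; rewrite horner_node_poly.
apply/prodf_neq0 => r _; rewrite subr_eq0 (inj_eq (node_inj eps0)).
by rewrite gtn_eqF.
Qed.

Section Assembly.
Variables (R : realType) (a b : R) (K D : nat) (nu : signature (K + D)).
Hypotheses (a1 : -1 < a) (ab : -1 <= a + b).
Let eps := (a + b + 1) / 2.

Let eps0 : 0 <= eps. Proof. by move: ab; rewrite /eps; lra. Qed.

(** The preimage of g_(K-j) F_N under [gfun_map], by [gfun_mul_FN]. *)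
Definition gfun_poly (n : nat) (j : 'I_K) : {poly R} :=
  \sum_(r < K) gfun_mx a eps K D j r *: jac_interp a eps nu D n (pole_poly eps K D r).

Let half_vandermonde := half_prod R K *: vandermonde_prod R K.

Let half_vandermonde_neq0 : half_vandermonde != 0.
Proof.
by rewrite scaler_eq0 negb_or half_prod_neq0 vandermonde_prod_neq0.
Qed.

Lemma gfun_poly_expand (n : nat) :
  exists g : 'I_K -> nat -> R,
    forall j, gfun_poly n j = \sum_(k < n) g j k *: jac_poly a eps k.
Proof.
suff /fin_all_exists : forall j, exists g : nat -> R,
    gfun_poly n j = \sum_(k < n) g k *: jac_poly a eps k by [].
move=> j; apply: poly_basis_expand => [k|]; first exact: size_jac_poly.
rewrite /gfun_poly; apply: (leq_trans (size_sum _ _ _)); apply/bigmax_leqP => r _.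
by rewrite (leq_trans (size_scale_leq _ _)) // size_jac_interp.
Qed.

Lemma alternant_gfun_poly (n : nat) :
  (forall i, (shifted nu i < D + n)%N) -> (K <= n)%N ->
  alternant (gfun_poly n) =
  (jac_norm_prod a K * \prod_(k < K) (node_poly eps k).[node eps k])%:MP *
   (half_vandermonde * specialize K (mjacobi_normalized a b nu)).
Proof.
move=> nun Kn.
rewrite (specialize_mjacobi_alternant a1 ab nun Kn (pole_poly_monic eps K D)
  (size_pole_poly eps K D)) -/eps mul_mpolyC scalerA.
rewrite (alternant_mulmx (gfun_mx a eps K D)
  (fun r => jac_interp a eps nu D n (pole_poly eps K D r))); congr (_ *: _).
have := det_gfun_mx eps K D a1.
have d0 := jac_norm_prod_neq0 D a1; have n0 := jac_norm_prod_neq0 (K + D) a1.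
move=> eqdet; apply: (mulIf n0); rewrite eqdet; field.
by rewrite n0.
Qed.

(** An expansion must be exhibited for the choice in [Lambda] to be meaningful: the alternant of the
    [gfun_poly] is expanded by Cauchy-Binet on the alternants of the J_k, and the Vandermonde factor
    is then cancelled. *)
Lemma Lambda_expansion :
  expansion (@mpolyC K R) (@mjacobi_normalized R a b K)
    (specialize K (mjacobi_normalized a b nu)) (Lambda a b nu).
Proof.
suff [c cP] : exists c, expansion (@mpolyC K R) (@mjacobi_normalized R a b K)
    (specialize K (mjacobi_normalized a b nu)) c.
  exact: (@epsilon_spec _ _ (fun c => expansion _ _ _ c) (ex_intro _ c cP)).
pose n := (K + \sum_i (shifted nu i).+1)%N.
have nun i : (shifted nu i < D + n)%N by rewrite /n (bigD1 i) //=; lia.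
have Kn : (K <= n)%N by rewrite leq_addr.
have [g gE] := gfun_poly_expand n.
have [t tE] := @det_expansion R _ (@mpolyC K R) K n (\matrix_(j < K, k < n) g j k)
  (fun k s => ueval (jac_poly a eps k) s).
have altE : alternant (gfun_poly n) = \sum_(p <- t) p.2%:MP *
    alternant (fun i => jac_poly a eps (shifted p.1 i)).
  rewrite -tE -alternant_lincomb; congr (\det _); apply/matrixP => j s.
  by rewrite !mxE gE; congr ueval; apply: eq_bigr => k _; rewrite mxE.
pose C := jac_norm_prod a K * \prod_(k < K) (node_poly eps k).[node eps k].
have C0 : C != 0 by rewrite mulf_neq0 ?jac_norm_prod_neq0 ?prod_node_poly_neq0.
(* The coefficients are rescaled from alternants of J_k to normalized Jacobi polynomials, and
   divided by the constant [C] of [alternant_gfun_poly]. *)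
pose t' := [seq (p.1, C^-1 * (p.2 * (jac_norm_prod a K * node_vandermonde eps p.1))) | p <- t].
have [c cE] := expansion_sum (@mpolyC K R) (@mjacobi_normalized R a b K) t'.
exists c; have eq_sum : specialize K (mjacobi_normalized a b nu) =
    \sum_(p <- t') p.2%:MP * mjacobi_normalized a b p.1; last by rewrite eq_sum.
apply: (mulfI half_vandermonde_neq0).
have CP : C%:MP_[K] != 0 by rewrite mpolyC_eq0.
apply: (mulfI CP); rewrite -(alternant_gfun_poly nun Kn) altE !mulr_sumr big_map.
apply: eq_bigr => p _ /=.
rewrite [half_vandermonde * _]mulrCA (mjacobi_normalized_alternant p.1 a1 ab) -/eps.
rewrite !mul_mpolyC !scalerA; congr (_ *: _).
have alg (F : fieldType) (w x y z : F) : w != 0 -> x != 0 -> y != 0 ->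
    z = w * (w^-1 * (z * (x * y))) * (x * y)^-1.
  by move=> w0 x0 y0; rewrite mulVKf // mulfK ?mulf_neq0.
by apply: alg; rewrite // ?jac_norm_prod_neq0 ?node_vandermonde_neq0.
Qed.

(** The same alternant is expanded in two ways, through [Lambda] and through the coordinates [g],
    and the coefficients at [kappa] are compared. The bound [n] must exceed the shifted entries on
    the support of [Lambda]; [n0] lets it be enlarged further. *)
Lemma Lambda_dK_det (n0 : nat) (kappa : signature K) :
  exists n (g : 'I_K -> nat -> R), [/\ (n0 <= n)%N,
    forall j, gfun_poly n j = \sum_(k < n) g j k *: jac_poly a eps k,
    forall i, (shifted kappa i < n)%N &
    Lambda a b nu kappa / dK kappa eps = \det (\matrix_(i < K, s < K) g i (shifted kappa s))].
Proof.
have [r [ur r0 rE]] := Lambda_expansion.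
pose n := (n0 + K + \sum_i (shifted nu i).+1 +
  \sum_(lam <- kappa :: r) \sum_i (shifted lam i).+1)%N.
have nun i : (shifted nu i < D + n)%N.
  by rewrite /n [X in (n0 + K + X)%N](bigD1 i) //=; lia.
have rn lam i : lam \in kappa :: r -> (shifted lam i < n)%N.
  by move=> lr; rewrite /n (big_rem lam) //= (bigD1 i) //=; lia.
have Kn : (K <= n)%N by rewrite /n; lia.
have [g gE] := gfun_poly_expand n.
exists n, g; split=> //; first by rewrite /n; lia.
  by move=> i; apply: rn; rewrite mem_head.
pose C := jac_norm_prod a K * \prod_(k < K) (node_poly eps k).[node eps k].
(* The coefficient of the alternant of [lam] in [alternant (gfun_poly n)]; at [kappa] it equals
   Lambda / d_K by [dKE]. *)
pose c (lam : signature K) := C * Lambda a b nu lam / (jac_norm_prod a K * node_vandermonde eps lam).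
rewrite -(@alternant_coef R (jac_poly a eps) _ K n r c g kappa) //.
- rewrite dKE /c /C; field.
  rewrite prod_node_poly_neq0 // node_vandermonde_neq0 // jac_norm_prod_neq0 //.
- by move=> k; apply: size_jac_poly.
- by move=> lam lr; rewrite /c r0 // mulr0 mul0r.
transitivity (alternant (gfun_poly n)).
  by congr (\det _); apply/matrixP => i s; rewrite !mxE gE.
rewrite alternant_gfun_poly // rE !mulr_sumr; apply: eq_bigr => lam _.
rewrite [half_vandermonde * _]mulrCA (mjacobi_normalized_alternant lam a1 ab) -/eps.
by rewrite !mul_mpolyC !scalerA.
Qed.

End Assembly.

Theorem theoremB (R : realType) (a b : R) (N K : nat)
    (nu : signature N) (kappa : signature K) :
  -1 < a -> -1 < b -> -1 <= a + b -> (1 <= K)%N -> (K < N)%N ->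
  let eps := (a + b + 1) / 2 in
  let L := (N - K + 1)%N in
  (Lambda a b nu kappa / dK kappa eps)%:C =
  \det (\matrix_(i < K, j < K)
     gcoef a eps L (gfun a eps L (K - j.+1) * FN nu eps) (shifted kappa i)).
Proof.
move=> a1 _ ab _ KN eps L.
(* With N = K + D, L becomes D + 1. *)
have [D ND] : exists D, N = (K + D)%N by exists (N - K)%N; lia.
subst N; rewrite {}/L addKn {KN}.
have eps0 : 0 <= eps by rewrite /eps; lra.
have [n [g [n0n gE kn LdK]]] :=
  Lambda_dK_det nu a1 ab (\sum_i (shifted nu i).+1) kappa.
have nun i : (shifted nu i < D + n)%N.
  by apply: leq_trans (leq_addl _ _); apply: leq_trans n0n; rewrite (bigD1 i) //= leq_addr.
(* The rows of [g] are indexed by j, whereas j indexes columns here, hence the transposition. *)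
rewrite {}LdK -det_tr -det_map_mx; congr (\det _); apply/matrixP => s j.
rewrite !mxE; symmetry; apply: gcoefP => //.
  exact: (calF_gfun_mul_FN nu j a1 eps0).
rewrite -[X in gfun _ _ _ X]/(rev_ord j : nat) (gfun_mul_FN j a1 eps0 nun).
rewrite -/(gfun_poly _ _ _ _ _) gE gfun_map_sum; apply: eq_bigr => k _.
by rewrite gfun_map_jac_poly.
Qed.
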